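(* Let $m\geq 2$, let $Q_{4m}=\langle a,b\mid a^{2m}=1,\ b^{2}=a^{m},\ bab^{-1}=a^{-1}\rangle$ be the generalized quaternion group of order $4m$, let $V$ be a rational FPF representation of $Q_{4m}$ of dimension $n=\dim_{\mathbb{Q}}V$, let $L\subset V$ be a $Q_{4m}$-invariant full-rank lattice, and consider the induced $Q_{4m}$-action on $V_{\mathbb{C}}/L$. Then the orbifold Euler characteristic of $V_{\mathbb{C}}/(Q_{4m}\ltimes L)=(V_{\mathbb{C}}/L)/Q_{4m}$ is \[\chi_{\mathrm{orb}}(V_{\mathbb{C}}/(Q_{4m}\ltimes L))=2^{\frac{n}{2}-1}+\frac{1}{2}-\frac{1}{4m}+\frac{1}{4m}\sum_{p^k\mid 2m} \varphi(p^k)\left(p^{\frac{n}{\varphi(p^k)}}-1\right),\] where $p^k$ ranges over all prime power divisors of $2m$ ($p$ prime, $k\geq 1$).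
   Context: A rational FPF (fixed-point-free) representation of a finite group $G$ is a nonzero finite-dimensional $\mathbb{Q}$-vector space $V$ with a linear $G$-action such that $\det(g-\mathrm{id}\mid V)\neq 0$ for every non-identity $g\in G$. A $G$-invariant full-rank lattice $L\subset V$ is a $G$-stable free $\mathbb{Z}$-submodule spanned by a $\mathbb{Q}$-basis of $V$. Put $V_{\mathbb{C}}=V\otimes_{\mathbb{Q}}\mathbb{C}$; the action of $G$ extends $\mathbb{C}$-linearly to $V_{\mathbb{C}}$ and induces an action on the torus $V_{\mathbb{C}}/L\cong(\mathbb{C}/\mathbb{Z})^n$ by $g\cdot[x]=[gx]$. For a finite group $G$ acting on a space $X$, the orbifold Euler characteristic is $\chi_{\mathrm{orb}}(X/G):=\frac{1}{|G|}\sum_{g\in G}\chi(\operatorname{Fix}(g))$, where $\operatorname{Fix}(g)=\{x\in X: gx=x\}$ and $\chi$ is the ordinary Euler characteristic. $\varphi$ is Euler's totient function. *)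

(* Defs.v *)
From HB Require Import structures.
From mathcomp Require Import all_boot all_order all_algebra all_fingroup.
From mathcomp Require Import mxrepresentation complex freeg.
From mathcomp Require Import all_classical all_reals all_analysis.

Set Implicit Arguments.
Unset Strict Implicit.
Unset Printing Implicit Defensive.

Import Order.TTheory GRing.Theory Num.Theory.
Import numFieldNormedType.Exports.

Local Open Scope classical_set_scope.
Local Open Scope ring_scope.

(* The metric topology of the modulus on R[i]; the library's instances for
   numFieldType are keyed on variables and do not fire on the concrete type. *)
HB.instance Definition _ (R : realType) :=
  PseudoPointedMetric.copy R[i] R[i]^o.

Definition std_simplex (R : realType) (k : nat) : set 'rV[R]_k.+1 :=
  [set x | (forall i, 0 <= x ord0 i) /\ \sum_i x ord0 i = 1].
Arguments std_simplex : clear implicits.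

(* Insertion of a zero coordinate at position i. *)
Definition face_row (R : realType) (k : nat) (i : 'I_k.+2) (x : 'rV[R]_k.+1) :
    'rV[R]_k.+2 :=
  \row_j (if unlift i j is Some j' then x ord0 j' else 0).

Lemma face_row_simplex (R : realType) (k : nat) (i : 'I_k.+2)
    (x : std_simplex R k) : face_row i (set_val x) \in std_simplex R k.+1.
Proof.
have [x0 x1] := set_valP x; apply/mem_set; split=> [j|].
  by rewrite mxE; case: unliftP.
rewrite (bigD1_ord i) //= mxE unlift_none add0r -[RHS]x1.
by apply: eq_bigr => j _; rewrite mxE liftK.
Qed.

Definition face (R : realType) (k : nat) (i : 'I_k.+2) (x : std_simplex R k) :
    std_simplex R k.+1 :=
  exist _ (face_row i (set_val x)) (face_row_simplex i x).

Lemma face_row_continuous (R : realType) (k : nat) (i : 'I_k.+2) :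
  continuous (@face_row R k i).
Proof.
move=> x A [P Px PA].
exists (fun i0 j' => P ord0 (fintype.lift i j')) => [i0 j'|y yP].
  by have := Px ord0 (fintype.lift i j'); rewrite mxE liftK (ord1 i0).
apply: PA => i0 j; rewrite (ord1 i0) mxE.
case: unliftP => [j' ->|->]; first exact: yP.
by have /nbhs_singleton := Px ord0 i; rewrite mxE unlift_none.
Qed.

Lemma face_continuous (R : realType) (k : nat) (i : 'I_k.+2) :
  continuous (@face R k i).
Proof.
apply/continuousP => U [W oW <-].
have /continuousP/(_ _ oW) oW' := @face_row_continuous R k i.
by exists (face_row i @^-1` W).
Qed.

HB.instance Definition _ (R : realType) (k : nat) (i : 'I_k.+2) :=
  isContinuous.Build (std_simplex R k) (std_simplex R k.+1) (@face R k i)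
    (@face_continuous R k i).

Section SingularHomology.
Variables (R : realType) (X : topologicalType).

Definition singular_simplex (k : nat) := continuousType (std_simplex R k) X.

Definition singular_chain (k : nat) := {freeg (singular_simplex k) / rat}.

Definition simplex_boundary (k : nat) (s : singular_simplex k.+1) :
    singular_chain k :=
  \sum_(i < k.+2) (-1) ^+ i *: << (s \o @face R k i : singular_simplex k) >>.

Definition boundary (k : nat) (c : singular_chain k.+1) : singular_chain k :=
  fglift (@simplex_boundary k) c.

Definition is_cycle (k : nat) : singular_chain k -> Prop :=
  if k is k'.+1 then fun c => boundary c = 0 else fun=> True.

Definition is_boundary (k : nat) (c : singular_chain k) : Prop :=
  exists d : singular_chain k.+1, boundary d = c.

(* dim H_k(X; Q) = b: the classes of z_0, ..., z_(b-1) are a basis of the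
   quotient of the k-cycles by the k-boundaries. *)
Definition has_betti (k b : nat) : Prop :=
  exists z : 'I_b -> singular_chain k,
    [/\ forall i, is_cycle (z i),
        forall c, is_cycle c ->
          exists a : 'I_b -> rat, is_boundary (c - \sum_i a i *: z i)
      & forall a : 'I_b -> rat,
          is_boundary (\sum_i a i *: z i) -> forall i, a i = 0].

(* A relation, so that no default value is given to spaces whose rational
   homology is not finite-dimensional; e is determined by X. *)
Definition has_euler_char (e : int) : Prop :=
  exists (N : nat) (b : nat -> nat),
    [/\ forall k, has_betti k (b k),
        forall k, (N <= k)%N -> b k = 0%N
      & e = \sum_(k < N) (-1) ^+ k * (b k)%:Z].

End SingularHomology.

Definition fixed_points (X : Type) (f : X -> X) : set X := [set x | f x = x].

Definition has_orbifold_euler_char (R : realType) (gT : finGroupType)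
    (G : {group gT}) (X : topologicalType) (act : gT -> X -> X) (e : R) : Prop :=
  exists chi : gT -> int,
    (forall g, g \in G ->
       has_euler_char R (set_type (fixed_points (act g))) (chi g)) /\
    e = #|G|%:R^-1 * \sum_(g in G) (chi g)%:~R.
Arguments has_orbifold_euler_char R {gT} G {X} act e.

(* The action on V = Q^n is by rG g *m v on column vectors, a left action. *)
Definition FPF_representation (gT : finGroupType) (G : {group gT}) (n : nat)
    (rG : mx_representation rat G n) : Prop :=
  (0 < n)%N /\
  forall g, g \in G -> g != 1%g -> \det (rG g - 1%:M) != 0.

Record lattice (n : nat) := Lattice {
  lattice_set :> 'cV[rat]_n -> Prop;
  lattice_basis : exists2 B : 'M[rat]_n, B \in unitmx &
    lattice_set = [set B *m map_mx intr z | z in [set: 'cV[int]_n]] :> set _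
}.

Definition lattice_invariant (gT : finGroupType) (G : {group gT}) (n : nat)
    (rG : mx_representation rat G n) (L : lattice n) : Prop :=
  forall g v, g \in G -> L v -> L (rG g *m v).

Section Torus.
Variables (R : realType) (n : nat) (L : lattice n).

(* The image of L in V_C = C^n. *)
Definition latticeC : {pred 'cV[R[i]]_n} :=
  fun x => `[< exists2 v : 'cV[rat]_n, L v & x = map_mx ratr v >].

Lemma latticeC_zmod_closed : zmod_closed latticeC.
Proof.
have [B _ LE] := lattice_basis L; split=> [|x y].
  apply/asboolP; exists 0; last by rewrite map_mx0.
  by rewrite LE; exists 0 => //; rewrite map_mx0 mulmx0.
move=> /asboolP[u Lu ->] /asboolP[v Lv ->]; apply/asboolP.
exists (u - v); last by rewrite map_mxB.
move: Lu Lv; rewrite LE => -[z _ <-] [w _ <-].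
by exists (z - w) => //; rewrite map_mxB mulmxBr.
Qed.

HB.instance Definition _ :=
  GRing.isZmodClosed.Build 'cV[R[i]]_n latticeC latticeC_zmod_closed.

Definition torus := quotient_topology (Quotient.quot latticeC).

HB.instance Definition _ := Topological.on torus.
HB.instance Definition _ := Quotient.on torus.

Definition torus_pi (x : 'cV[R[i]]_n) : torus := \pi_torus%qT x.

Lemma torus_piP (x y : 'cV[R[i]]_n) :
  torus_pi x = torus_pi y <->
  exists2 v : 'cV[rat]_n, L v & x - y = map_mx ratr v.
Proof. by split=> [/eqmodP/asboolP|h]; last exact/eqmodP/asboolP. Qed.

(* [x] |-> [A x], for a rational matrix A preserving L. *)
Definition torus_map (A : 'M[rat]_n) (t : torus) : torus :=
  torus_pi (map_mx ratr A *m generic_quotient.repr t).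

Lemma torus_map_pi (A : 'M[rat]_n) : (forall v, L v -> L (A *m v)) ->
  forall x, torus_map A (torus_pi x) = torus_pi (map_mx ratr A *m x).
Proof.
move=> LA x; apply/torus_piP; rewrite -mulmxBr.
have /torus_piP[v Lv ->] :
  torus_pi (generic_quotient.repr (torus_pi x)) = torus_pi x by exact: reprK.
by exists (A *m v); [exact: LA|rewrite map_mxM].
Qed.

End Torus.

(* Main.v *)
(* An orbifold Euler characteristic is an average of Euler characteristics of
   fixed-point sets in the torus [T = C^n / L].

   The identity fixes [T], whose Euler characteristic vanishes: singular
   simplices of [T] lift to [C^n], so the singular complex of [T] is the
   quotient of that of [C^n] by the translations in [L].  Dividing out the
   generators of [L] one at a time, each step is a short exact sequence
   [0 -> C -> C -> C' -> 0] with first map [t - 1], so that the homology of [C']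
   is assembled from the cokernel and the kernel of the same endomorphism in
   consecutive degrees, and the alternating sum of the dimensions telescopes
   to 0.

   An element [g <> 1] of order [d] has finitely many fixed points, namely
   [|det (g - 1)|] (Smith normal form).  All complex eigenvalues of [g] are
   primitive [d]-th roots of unity, so its characteristic polynomial is a power
   of the [d]-th cyclotomic polynomial, whose value at 1 is [p] when [d] is a
   power of the prime [p] and 1 for the other [d > 1].  Half of [Q_4m] is the
   cyclic group [<a>] of order [2m], and the other elements have order 4. *)

Require Import Defs.
From HB Require Import structures.
From mathcomp Require Import all_boot all_order all_algebra all_fingroup.
From mathcomp Require Import mxrepresentation complex freeg.
From mathcomp Require Import all_classical all_reals all_analysis.
From mathcomp Require Import cyclic algC cyclotomic.
From mathcomp Require Import zify ring lra.

Set Implicit Arguments.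
Unset Strict Implicit.
Unset Printing Implicit Defensive.

Import Order.TTheory GRing.Theory Num.Theory.
Import numFieldNormedType.Exports.

Local Open Scope ring_scope.

(** * Finite index of sublattices *)

(** The intermediate quotient complexes are never formed: each is a complex with a predicate read as
    being zero, and its homology is described by chains independent and spanning modulo that
    predicate. The map [t - 1] is injective because a finite chain cannot be constant along an
    infinite orbit. Its kernel and cokernel on homology have equal dimension because that homology
    is finite-dimensional, so finiteness is carried through all the generators. A finite fixed set
    still needs an argument, since its Euler characteristic is defined by singular simplices: they
    are constant because [g - 1] maps their lifts to [C^n] into the discrete lattice. In the
    formula, each of the [2m] elements outside [<a>] contributes [2^(n/2)], whence [2^(n/2-1)] after
    division by [4m]. Replacing each power by itself minus 1 in the sum over [<a>] leaves the
    totients of the divisors [d > 1] of [2m], whose sum [2m - 1] accounts for [1/2 - 1/(4m)]. *)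

Lemma lattice_index n (C : 'M[int]_n) : \det C != 0 ->
  exists r : 'I_`|\det C|%N -> 'cV[int]_n,
    (forall z, exists i y, z = r i + C *m y) /\
    (forall i j y, r i - r j = C *m y -> i = j).
Proof.
have [P uP [Q uQ [d _ ->]]] := int_Smith_normal_form C.
pose e (i : nat) : int := d`_i.
set D := \matrix_(i, j) _ => detC.
have DE : D = diag_mx (\row_(i < n) d`_i).
  by apply/matrixP => i j; rewrite !mxE.
have abs_unit (U : 'M[int]_n) : U \in unitmx -> `|\det U|%N = 1%N.
  rewrite unitmxE => /unitrP[y [/(congr1 absz) + _]]; rewrite abszM => /eqP.
  by rewrite muln_eq1 => /andP[_ /eqP].
have cardE : #|{dffun forall i :
  'I_n, 'I_(absz (e i))}| = `|\det (P *m D *m Q)|%N.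
  rewrite card_dep_ffun !det_mulmx !abszM (abs_unit P) // (abs_unit Q) // mul1n
    muln1 DE det_diag.
  rewrite foldrE big_map big_enum /=.
  rewrite (big_morph absz abszM (id1 := 1%N)) //.
  by apply: eq_bigr => i _; rewrite card_ord mxE.
have d0 i : (i < n)%N -> e i != 0.
  move=> lt_in; apply: contraNneq detC => di0.
  rewrite !det_mulmx DE det_diag (bigD1 (Ordinal lt_in)) //= mxE -/(e i) di0.
  by rewrite mul0r mulr0 mul0r.
rewrite -cardE.
(* The image of [C = P D Q] is [P] applied to the vectors whose coordinates are multiples of the
   [e i], so the box of residues, transported by [P], is a transversal. *)
pose r (f : {dffun forall i : 'I_n, 'I_(absz (e i))}) : 'cV[int]_n :=
  P *m \col_i (f i : nat)%:Z.
exists (fun i => r (enum_val i)); split.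
  move=> z; have {z} [z' ->] : exists z', z = P *m z'.
    by exists (invmx P *m z); rewrite mulKVmx.
  have modlt (i : 'I_n) : (absz (z' i ord0 %% e i)%Z < absz (e i))%N.
    have := ltz_mod (z' i ord0) (d0 i (ltn_ord i)).
    have := modz_ge0 (z' i ord0) (d0 i (ltn_ord i)); lia.
  pose f : {dffun forall i : 'I_n, 'I_(absz (e i))} := [ffun i =>
    Ordinal (modlt i)].
  exists (enum_rank f), (invmx Q *m \col_i (z' i ord0 %/ e i)%Z).
  rewrite enum_rankK mulmxA mulmxK // -mulmxA -mulmxDr.
  congr (_ *m _); apply/colP => i.
  rewrite DE mul_diag_mx !mxE ffunE /= gez0_abs ?modz_ge0 ?d0 //.
  by rewrite addrC mulrC {1}(divz_eq (z' i ord0) (e i)).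
move=> i j y; rewrite /r -mulmxBr -!mulmxA => /(can_inj (mulKmx uP)) h.
apply: enum_val_inj; apply/ffunP => l; apply: val_inj => /=.
have := congr1 (fun v : 'cV[int]_n => v l 0) h.
rewrite DE mul_diag_mx !mxE.
set a := enum_val i l; set b := enum_val j l; set c := (Q *m y) l 0.
have := ltn_ord a; have := ltn_ord b; move: (nat_of_ord a) (nat_of_ord b).
move=> {a b h} a b lt_b lt_a ab.
(* Both residues lie between 0 and [|e l| - 1], so a difference divisible by [e l] vanishes. *)
have /dvdzP[q] : (e l %| a%:Z - b%:Z)%Z by rewrite ab dvdz_mulr.
have [->|q0] := eqVneq q 0; first by rewrite mul0r => /eqP;
  rewrite subr_eq0 => /eqP[].
move=> /(congr1 absz); rewrite abszM => h.
have : (absz (e l) <= absz q * absz (e l))%N by rewrite leq_pmull // absz_gt0.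
lia.
Qed.

(** * Cyclotomic polynomials and determinants *)

Lemma prime_power_pdiv p k : prime p -> (0 < k)%N ->
  (pdiv (p ^ k) = p /\ logn p (p ^ k) = k)%N.
Proof.
move=> pr_p k0; split; last by rewrite pfactorK.
by case: k k0 => // k _; rewrite pdiv_pfactor.
Qed.

Section PrimePowerDivisors.
Variables (R : Type) (idx : R) (op : Monoid.com_law idx) (f : nat -> R) (N :
  nat).
Hypothesis N_gt0 : (0 < N)%N.
Hypothesis f_idx : forall d, (1 < d)%N ->
  (forall p k, prime p -> (0 < k)%N -> d <> (p ^ k)%N) -> f d = idx.

(** A prime power [d > 1] determines its prime [pdiv d] and its exponent, so such divisors regroup
    as pairs. The operation is abstract because the lemma serves both the product of the values
    [prime_base] and the sum in the final formula. *)
Lemma big_prime_power_divisors :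
  \big[op/idx]_(d < N.+1 | (1 < d)%N && (d %| N)%N) f d =
  \big[op/idx]_(0 <= p < N.+1 | prime p)
    \big[op/idx]_(1 <= k < N.+1 | (p ^ k %| N)%N) f (p ^ k)%N.
Proof.
pose pp d := [&& (1 < d)%N, (d %| N)%N & d == (pdiv d ^ logn (pdiv d) d)%N].
transitivity (\big[op/idx]_(d < N.+1 | pp d) f d).
  rewrite big_mkcond [RHS]big_mkcond; apply: eq_bigr => d _; rewrite /pp.
  case: ltnP => //= d1; case: (_ %| _)%N => //=; case: eqP => // ne.
  apply: f_idx => // p k pr_p k0 dE; apply: ne.
  by rewrite dE; have [-> ->] := prime_power_pdiv pr_p k0.
have N_le d : (d %| N)%N -> (d < N.+1)%N by rewrite ltnS; exact: dvdn_leq.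
have pdiv_lt d : pp d -> (pdiv d < N.+1)%N.
  move=> /and3P[d1 dN _]; apply: leq_ltn_trans (N_le _ dN).
  by apply: pdiv_leq; exact: ltnW.
rewrite big_mkord (partition_big (fun d : 'I_N.+1 => inord (pdiv d))
  (fun p : 'I_N.+1 => prime p)) => [|d ppd]; last first.
  by rewrite inordK ?pdiv_lt //; have /and3P[d1 _ _] := ppd; exact: pdiv_prime.
apply: eq_bigr => p pr_p; rewrite big_geq_mkord.
have inner (d : 'I_N.+1) : pp d && (inord (pdiv d) == p) ->
    [/\ (1 < d)%N, (d %| N)%N & d = (p ^ logn p d)%N :> nat].
  move=> /andP[ppd /eqP dp]; have /and3P[d1 dN /eqP dE] := ppd.
  by have := congr1 val dp; rewrite /= inordK ?pdiv_lt // => <-.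
rewrite (reindex_onto (fun k : 'I_N.+1 => inord (p ^ k)%N)
  (fun d : 'I_N.+1 => inord (logn p d))) => [|d /inner[d1 dN dE]]; last first.
  have ld : (logn p d < N.+1)%N.
    apply: ltn_trans (ltn_ord d).
    by rewrite [X in (_ < X)%N]dE ltn_expl // prime_gt1.
  by rewrite (inordK ld) -dE inord_val.
have p1 : (1 < p)%N by exact: prime_gt1.
have pk_lt (k : nat) : (p ^ k %| N)%N -> (p ^ k < N.+1)%N by exact: N_le.
apply: eq_big => [k|k /andP[/inner[d1 dN dE] /eqP kE]].
  apply/andP/andP => [[/inner[d1 dN dE] /eqP kE]|[pkN k0]].
    (* [p ^ k] may exceed [N], in which case [inord] returns a default value; the exponent is
       therefore recovered from the round trip [kE]. *)
    have lk : logn p (inord (p ^ k)%N : 'I_N.+1) = k.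
      have := congr1 val kE; rewrite /= inordK //.
      apply: ltn_trans (ltn_ord (inord (p ^ k)%N : 'I_N.+1)).
      by rewrite [X in (_ < X)%N]dE ltn_expl.
    rewrite lk in dE; rewrite -dE; split=> //.
    by rewrite lt0n; apply: contraTneq d1 => k0; rewrite dE k0.
  have [pE lE] := prime_power_pdiv pr_p k0.
  rewrite /pp inordK ?pk_lt // pE lE pkN eqxx !inord_val !eqxx andbT.
  by split=> //; rewrite !andbT -(expn0 p) ltn_exp2l.
have lk : logn p (inord (p ^ k)%N : 'I_N.+1) = k.
  have := congr1 val kE; rewrite /= inordK //.
  apply: ltn_trans (ltn_ord (inord (p ^ k)%N : 'I_N.+1)).
  by rewrite [X in (_ < X)%N]dE ltn_expl.
by rewrite dE lk.
Qed.

End PrimePowerDivisors.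

(* The value at 1 of the [d]-th cyclotomic polynomial, for [d > 1]. *)
Definition prime_base (d : nat) : nat :=
  if d == (pdiv d ^ logn (pdiv d) d)%N then pdiv d else 1%N.

Lemma prime_base_prime_power p k :
  prime p -> (0 < k)%N -> prime_base (p ^ k) = p.
Proof.
by move=> pr_p k0; rewrite /prime_base;
  have [-> ->] := prime_power_pdiv pr_p k0; rewrite eqxx.
Qed.

Lemma prime_base_not_prime_power d : (1 < d)%N ->
  (forall p k, prime p -> (0 < k)%N -> d <> (p ^ k)%N) -> prime_base d = 1%N.
Proof.
move=> d1 h; rewrite /prime_base; case: eqP => // dE.
have pr_p := pdiv_prime d1; case: (h _ _ pr_p _ dE).
by rewrite lt0n; apply: contraTneq d1 => l0; rewrite dE l0.
Qed.

(** Each prime [p] contributes one factor [p] for every [k >= 1] with [p ^ k] dividing [N], hence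
    [p ^ logn p N]. *)
Lemma prod_prime_base N : (0 < N)%N ->
  (\prod_(d < N.+1 | (1 < d) && (d %| N)) prime_base d = N)%N.
Proof.
move=> N0.
rewrite (big_prime_power_divisors _ N0 prime_base_not_prime_power) /=.
rewrite -[RHS](partnT N0) /partn [RHS]big_mkcond [LHS]big_mkcond.
apply: eq_bigr => p _ /=; case: ifP => [pr_p|npr]; last first.
  by rewrite lognE npr expn0.
rewrite (eq_bigl (fun k => (k < (logn p N).+1)%N)) => [|k];
  last exact: pfactor_dvdn.
rewrite big_nat_cond.
rewrite (eq_bigr (fun=> p)) => [|k /andP[/andP[k1 _] _]]; last first.
  exact: prime_base_prime_power.
rewrite -big_nat_cond -(big_nat_widen _ _ _ xpredT) ?prod_nat_const_nat ?subn1
  //.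
by rewrite ltnS ltnW // ltn_logl.
Qed.

Lemma big_divisors (R : Type) (idx : R) (op : Monoid.com_law idx) N (P :
  pred nat)
    (f : nat -> R) : (0 < N)%N ->
  \big[op/idx]_(d <- divisors N | P d) f d =
  \big[op/idx]_(d < N.+1 | (d %| N)%N && P d) f d.
Proof.
move=> N0; rewrite -(big_mkord (fun d => (d %| N)%N && P d)) -big_filter_cond.
apply: perm_big; apply: uniq_perm; first exact: divisors_uniq.
  exact/filter_uniq/iota_uniq.
move=> d; rewrite mem_filter mem_index_iota -dvdn_divisors // andb_idr //.
by rewrite ltnS; exact: dvdn_leq.
Qed.

Lemma Cyclotomic1 : 'Phi_1 = 'X - 1.
Proof.
have := @prod_Cyclotomic 1 isT; rewrite expr1 => <-.
by rewrite /divisors /= big_seq1.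
Qed.

(** Cancel [X - 1] in the factorization of [X ^ N - 1]: the quotient [1 + X + ... + X ^ (N - 1)]
    takes the value [N] at 1. *)
Lemma prod_Cyclotomic_at1 N : (0 < N)%N ->
  \prod_(d < N.+1 | (1 < d)%N && (d %| N)%N) ('Phi_d).[1] = N%:R :> int.
Proof.
move=> N0; have := prod_Cyclotomic N0.
rewrite (bigD1_seq 1%N) /= ?divisors_uniq -?dvdn_divisors ?dvd1n //.
rewrite Cyclotomic1 subrX1 => /mulfI.
rewrite -[1]polyC1 polyXsubC_eq0 => /(_ isT)/(congr1 (horner^~ 1)).
rewrite horner_prod big_divisors // horner_sum.
rewrite [RHS](eq_bigr (fun=> 1)) => [|i _]; last by rewrite hornerXn expr1n.
rewrite sumr_const card_ord => <-; apply: eq_bigl => d.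
rewrite andbC; case dN : (d %| N)%N => //=.
by have := dvdn_gt0 N0 dN; case: (nat_of_ord d) => [//|[|]].
Qed.

(** Strong induction: both families have product [d] over the divisors of [d] greater than 1. The
    factors at proper divisors agree and are nonzero, so the factors at [d] agree. *)
Lemma Cyclotomic_at1 d : (1 < d)%N -> ('Phi_d).[1] = (prime_base d)%:R :> int.
Proof.
elim/ltn_ind: d => d IH d1; have d0 := ltnW d1.
have ord_d : (d < d.+1)%N by [].
have := prod_Cyclotomic_at1 d0.
rewrite -[in RHS](prod_prime_base d0) natr_prod.
rewrite (bigD1 (Ordinal ord_d)) /= ?d1 ?dvdnn //.
rewrite [RHS](bigD1 (Ordinal ord_d)) /= ?d1 ?dvdnn //.
set p := (X in _ * X = _ -> _); set q := (X in _ = _ * X -> _).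
have -> : p = q.
  apply: eq_bigr => e /andP[/andP[e1 _] ed]; apply: IH => //.
  rewrite ltn_neqAle -ltnS ltn_ord andbT; move: ed.
  by rewrite -val_eqE.
move=> /mulIf; apply.
rewrite /q -natr_prod pnatr_eq0 -lt0n.
have : (0 < d)%N by [].
rewrite -{1}(prod_prime_base d0) (bigD1 (Ordinal ord_d)) /= ?d1 ?dvdnn //.
by rewrite muln_gt0 => /andP[].
Qed.

(* ['Phi_d] is the minimal polynomial of each of its roots. *)
Lemma primitive_roots_power d (q : {poly rat}) : q \is monic ->
  (forall z : algC, root (map_poly ratr q) z -> d.-primitive_root z) ->
  exists k, q = map_poly intr 'Phi_d ^+ k.
Proof.
have [m] := ubnP (size q); elim: m q => // m IH q.
rewrite ltnS => q_m q_mon q_root.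
have [/eqP q1|q1] := boolP (size q == 1%N).
  exists 0%N; rewrite expr0; have [c c0 qE] := size_poly1P _ (introT eqP q1).
  by move: q_mon; rewrite qE monicE lead_coefC => /eqP ->.
have [z qz] : exists z : algC, root (map_poly ratr q) z.
  by apply/closed_rootP; rewrite size_map_poly.
have z_prim := q_root z qz.
have PhiE : map_poly ratr (map_poly intr 'Phi_d : {poly rat}) = minCpoly z.
  rewrite (minCpoly_cyclotomic z_prim) -(Cintr_Cyclotomic z_prim)
    -map_poly_comp.
  by apply: eq_map_poly => i /=; rewrite ratr_int.
have Phi_mon : map_poly intr 'Phi_d \is @monic rat.
  by apply: monic_map; exact: Cyclotomic_monic.
have [p [pE p_mon] pP] := minCpolyP z.
have pPhi : p = map_poly intr 'Phi_d.
  by apply: (map_poly_inj (@ratr algC)); rewrite PhiE.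
have : p %| q by rewrite -pP.
rewrite pPhi => /dvdpP[r qE].
have r_mon : r \is monic by move: q_mon; rewrite qE monicMr.
have [k rE] : exists k, r = map_poly intr 'Phi_d ^+ k.
  apply: IH => //.
    apply: leq_trans q_m; rewrite qE size_Mmonic ?monic_neq0 //.
    rewrite [size (map_poly _ _)]size_map_poly_id0 ?(eqP (Cyclotomic_monic d))
      //.
    rewrite size_Cyclotomic addnS /= -[X in (X < _)%N]addn0 ltn_add2l.
    by rewrite totient_gt0 (prim_order_gt0 z_prim).
  by move=> y ry; apply: q_root; rewrite qE rmorphM rootM ry.
by exists k.+1; rewrite qE rE exprSr.
Qed.

Lemma char_poly_at1 (F : comNzRingType) n (M : 'M[F]_n) :
  (char_poly M).[1] = \det (1%:M - M).
Proof.
rewrite /char_poly -horner_evalE -det_map_mx; congr determinant.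
apply/matrixP => i j; rewrite !mxE /= horner_evalE hornerD hornerN hornerC.
by case: (i == j); rewrite ?mulr1n ?mulr0n ?hornerX ?hornerC.
Qed.

Lemma det_opp_mx (F : comNzRingType) n (M : 'M[F]_n) :
  \det (- M) = (-1) ^+ n * \det M.
Proof. by rewrite -scaleN1r detZ. Qed.

(** [P k] is the [k]-th power of [M], later [rG (g ^+ k)]. The degree of the characteristic
    polynomial, a power of ['Phi_d], gives [n], and its value at 1 gives the determinant. *)
Lemma det_fixed_point_free n (M : 'M[rat]_n) (P : nat -> 'M[rat]_n) d :
  (1 < d)%N -> P 0%N = 1%:M -> (forall k, P k.+1 = M *m P k) -> P d = 1%:M ->
  (forall k, (0 < k < d)%N -> \det (P k - 1%:M) != 0) ->
  exists2 k, n = (k * totient d)%N &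
    `|\det (M - 1%:M)| = (prime_base d ^ k)%:R.
Proof.
move=> d1 P0 PS Pd Pfree; have d0 := ltnW d1.
have [k ME] : exists k, char_poly M = map_poly intr 'Phi_d ^+ k.
  apply: primitive_roots_power; first exact: char_poly_monic.
  move=> z; rewrite map_char_poly -eigenvalue_root_char =>
    /eigenvalueP[v vM v0].
  have vP k : v *m map_mx ratr (P k) = z ^+ k *: v.
    elim: k => [|k IH]; first by rewrite P0 map_mx1 mulmx1 expr0 scale1r.
    by rewrite PS map_mxM mulmxA vM -scalemxAl IH scalerA exprS.
  have zd : z ^+ d = 1.
    have := vP d; rewrite Pd map_mx1 mulmx1 -{1}[v]scale1r => /eqP.
    rewrite -subr_eq0 -scalerBl scaler_eq0 (negPf v0) orbF subr_eq0.
    by move=> /eqP.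
  have [e e_prim ed] := prim_order_exists d0 zd.
  have [<- //|ne] := eqVneq e d.
  have e0 := prim_order_gt0 e_prim.
  (* An eigenvalue of order [e < d] would make its eigenvector [v] fixed by [P e], against the
     invertibility of [P e - 1]. *)
  have /Pfree det0 : (0 < e < d)%N by rewrite e0 ltn_neqAle ne dvdn_leq.
  have uPe : map_mx ratr (P e - 1%:M) \in @unitmx algC n.
    by rewrite map_unitmx unitmxE unitfE.
  case/negP: v0; rewrite -[v](mulmxK uPe).
  by rewrite map_mxB map_mx1 mulmxBr mulmx1 vP (prim_expr_order e_prim) scale1r
    subrr mul0mx.
exists k.
  have := size_exp (map_poly intr 'Phi_d : {poly rat}) k.
  rewrite -ME size_char_poly size_map_poly_id0; last first.
    by rewrite (eqP (Cyclotomic_monic d)) oner_eq0.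
  by rewrite size_Cyclotomic mulnC.
have := char_poly_at1 M; rewrite ME horner_exp -[1]/(1%:~R) horner_map /=.
rewrite Cyclotomic_at1 // -[M - _]opprB det_opp_mx normrM normrX normrN1 expr1n
  mul1r.
by move=> /(congr1 Num.norm) <-; rewrite rmorph_nat normrX normr_nat natrX.
Qed.

(** * The generalized quaternion group *)

Section QuaternionModel.
Variables (m : nat) (m_gt1 : (1 < m)%N).
Local Notation Z := 'Z_(2 * m).

Let N_gt1 : (1 < 2 * m)%N. Proof. by rewrite (leq_trans m_gt1) ?leq_pmull. Qed.

Let twom0 : m%:R + m%:R = 0 :> Z.
Proof. by rewrite -natrD addnn -mul2n; exact: char_Zp. Qed.

(* The left regular representation: [(x, e)] stands for [a ^+ x * b ^+ e]. *)
Definition quaternion_left_a (u : Z * bool) : Z * bool := (u.1 + 1, u.2).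
Definition quaternion_left_b (u : Z * bool) : Z * bool :=
  if u.2 then (m%:R - u.1, false) else (- u.1, true).

Let left_a_inj : injective quaternion_left_a.
Proof.
move=> [x e] [y e'] /eqP; rewrite xpair_eqE /= => /andP[/eqP/addIr -> /eqP ->].
by [].
Qed.

Let left_b_inj : injective quaternion_left_b.
Proof.
move=> [x [|]] [y [|]] e; have := congr1 fst e; have := congr1 snd e => //= _.
  by move=> /addrI/oppr_inj ->.
by move=> /oppr_inj ->.
Qed.

Definition quaternion_perm_a : {perm Z * bool} := perm left_a_inj.
Definition quaternion_perm_b : {perm Z * bool} := perm left_b_inj.

Let permaX k u : (quaternion_perm_a ^+ k)%g u = (u.1 + k%:R, u.2).
Proof.
elim: k u => [|k IH] [x e]; first by rewrite expg0 perm1 addr0.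
by rewrite expgS permM permE IH /= -addrA nat1r.
Qed.

Let permb2 u : (quaternion_perm_b ^+ 2)%g u = (u.1 + m%:R, u.2).
Proof.
case: u => x [|]; rewrite expgS expg1 permM !permE /=; congr (_, _).
  by rewrite opprB -[in RHS](subrK m%:R x) -addrA twom0 addr0.
by rewrite opprK addrC.
Qed.

Definition quaternion_perms : {group {perm Z * bool}} :=
  <<[set quaternion_perm_a; quaternion_perm_b]>>%G.

(** Permutations compose from left to right, which reverses the order of left multiplications; the
    relations are equivalent to their reversals and hold all the same. *)
Lemma quaternion_perms_homg :
  (quaternion_perms \homg Grp (a : b :
     a ^+ (2 * m) = 1, b ^+ 2 = a ^+ m, b * a * b^-1 = a^-1))%g.
Proof.
apply/existsP; exists (quaternion_perm_a, quaternion_perm_b).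
rewrite /= !xpair_eqE; apply/and4P; split; apply/eqP.
- by rewrite joing_idl joing_idr.
- by apply/permP => -[x e]; rewrite permaX perm1 char_Zp // addr0.
- by apply/permP => u; rewrite permb2 permaX.
apply: (canLR (mulgK _)); apply: (canRL (mulKg _)).
apply/permP => -[x [|]]; rewrite !permM !permE /quaternion_left_a /=.
  by rewrite opprD addrA subrK.
by rewrite opprD subrK.
Qed.

(** The relations readily bound the order of the group from above; the model supplies the lower
    bound, since the orbit of [(0, false)] is the whole set of [4m] points. *)
Lemma card_quaternion_perms : (4 * m <= #|quaternion_perms|)%N.
Proof.
have cardT : #|[set: Z * bool]| = (4 * m)%N.
  by rewrite cardsT card_prod card_bool card_ord Zp_cast // mulnAC.
rewrite -cardT; pose e0 : Z * bool := (0, false).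
apply: leq_trans (leq_imset_card (fun s : {perm Z * bool} => s e0) _).
apply: subset_leq_card; apply/fintype.subsetP => -[x e] _.
apply/imsetP; exists (quaternion_perm_b ^+ e * quaternion_perm_a ^+ x)%g.
  by rewrite groupM ?groupX ?mem_gen ?inE ?eqxx ?orbT.
rewrite permM permaX.
have -> : (quaternion_perm_b ^+ e)%g e0 = (0, e).
  by case: e; rewrite ?expg1 ?expg0 ?perm1 ?permE //= /quaternion_left_b /=
    oppr0.
by rewrite add0r natr_Zp.
Qed.

End QuaternionModel.

Section QuaternionGroup.
Variables (m : nat) (m_gt1 : (1 < m)%N) (gT : finGroupType) (G : {group gT}).
Hypothesis G_iso : (G \isog Grp (a : b :
  a ^+ (2 * m) = 1, b ^+ 2 = a ^+ m, b * a * b^-1 = a^-1))%g.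

(** Every element lies in [<a>] or is [u b] with [u] in [<a>], so the order is at most twice that of
    [a], hence at most [4m]; the permutation model forces equality. Moreover [(u b)^2 = b^2 = a^m]
    has order 2, so [u b] has order 4. *)
Lemma quaternion_structure : exists a : gT,
  [/\ #[a]%g = (2 * m)%N, #|G| = (4 * m)%N,
      <[a]>%g \subset G
    & forall g, g \in G -> g \notin <[a]>%g -> #[g]%g = 4%N].
Proof.
have card_ge : (4 * m <= #|G|)%N.
  apply: leq_trans (card_quaternion_perms m_gt1) _.
  by apply: dvdn_leq => //; apply: card_homg;
    rewrite G_iso quaternion_perms_homg.
have /existsP[[a b]] := isoGrp_hom G_iso.
rewrite /= !xpair_eqE => /and4P[/eqP defG /eqP aN /eqP b2 /eqP bab].
exists a.
have aG : <[a]>%g \subset G by rewrite -defG joing_subl.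
have oa : (#[a]%g %| 2 * m)%N by rewrite order_dvdn aN.
have oa_le : (#[a]%g <= 2 * m)%N by rewrite dvdn_leq // muln_gt0 (ltnW m_gt1).
have conjE x : (b * x * b^-1 = x ^ b^-1)%g by rewrite conjgE invgK mulgA.
have conj_a u : u \in <[a]>%g -> (b * u * b^-1 = u^-1)%g.
  by move=> /cycleP[i ->]; rewrite conjE conjXg -conjE bab expgVn.
have bN : (<[b]> \subset 'N(<[a]>))%g.
  rewrite cycle_subG -groupV; apply/normP.
  by rewrite -cycleJ -conjE bab cycleV.
have G_cover g : g \in G -> g \notin <[a]>%g -> exists2 u,
  u \in <[a]>%g & g = (u * b)%g.
  rewrite -{1}defG norm_joinEr // => /mulsgP[u v ua /cycleP[k ->] ->].
  rewrite -[k]odd_double_half addnC -muln2 mulnC expgD (expgM b 2) b2 -expgM.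
  case: (odd k); rewrite ?expg1 ?expg0 => h.
    exists (u * a ^+ (m * k./2))%g; first by rewrite groupM ?mem_cycle.
    by rewrite mulgA.
  by case/negP: h; rewrite mulg1 groupM ?mem_cycle.
have G_le : (#|G| <= 2 * #[a]%g)%N.
  have : G \subset (<[a]> :|: <[a]> :* b)%g.
    apply/fintype.subsetP => g Gg; rewrite inE;
      case: (boolP (g \in <[a]>%g)) => //= ga.
    by have [u ua ->] := G_cover g Gg ga; rewrite mem_rcoset mulgK.
  move=> /subset_leq_card/leq_trans; apply.
  apply: leq_trans (leq_card_setU _ _) _.
  by rewrite card_rcoset addnn mul2n.
have oaE : #[a]%g = (2 * m)%N.
  apply/eqP; rewrite eqn_leq oa_le -(leq_pmul2l (isT : 0 < 2)%N) mulnA.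
  exact: leq_trans card_ge G_le.
split=> //.
  by apply/eqP; rewrite eqn_leq card_ge andbT; move: G_le; rewrite oaE mulnA.
move=> g Gg ga; have [u ua gE] := G_cover g Gg ga.
have g2 : (g ^+ 2 = a ^+ m)%g.
  have := conj_a u ua; rewrite gE expgS expg1 => /(canRL (mulgKV _)) bu.
  by rewrite -mulgA [(b * (u * b))%g]mulgA bu -mulgA mulKVg -b2 expgS expg1.
have : (#[g]%g %| 2 ^ 2)%N by rewrite order_dvdn (expgM g 2 2) g2 -expgM mulnC
  aN.
have : ~~ (#[g]%g %| 2)%N.
  rewrite order_dvdn g2 -order_dvdn oaE; apply/negP => /(dvdn_leq (ltnW m_gt1)).
  by rewrite -{2}[m]mul1n leq_pmul2r // ltnW.
move=> n2 /(dvdn_pfactor _ 2 (isT : prime 2))[k k2 gk]; move: k2 n2; rewrite gk.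
by case: k {gk} => [|[|[|k]]].
Qed.

Lemma sum_cyclic_order (V : nmodType) (a : gT) (f : nat -> V) :
  \sum_(g in <[a]>%g) f #[g]%g =
  \sum_(d < #[a]%g.+1 | (d %| #[a]%g)%N) f d *+ totient d.
Proof.
have od g : g \in <[a]>%g -> (#[g]%g %| #[a]%g)%N.
  by move=> ga; rewrite orderE [#[a]%g]orderE cardSg // cycle_subG.
have od_lt g : g \in <[a]>%g -> (#[g]%g < #[a]%g.+1)%N.
  by move=> /od/dvdn_leq; rewrite ltnS; apply.
rewrite (partition_big (fun g => inord #[g]%g : 'I_#[a]%g.+1)
  (fun d => (d %| #[a]%g)%N)) => [|g ga]; last by rewrite inordK ?od ?od_lt.
apply: eq_bigr => d da.
rewrite (eq_bigr (fun=> f d)) => [|g /andP[ga /eqP <-]];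
  last by rewrite inordK ?od_lt.
rewrite big_const iter_addr addr0; congr (_ *+ _).
(* The elements of order [d] are the generators of the unique subgroup of order [d], here
   [<[c]>]. *)
pose c := (a ^+ (#[a] %/ d))%g.
have d0 : (0 < d)%N by rewrite (dvdn_gt0 _ da).
have oc : #[c]%g = d by rewrite orderXdiv ?dvdn_div // divnA ?mulKn.
rewrite -oc totient_gen; apply: eq_card => g; rewrite !inE /generator.
have cA : <[c]>%g \subset <[a]>%g by rewrite cycle_subG mem_cycle.
apply/andP/eqP => [[ga /eqP gd]|cg].
  have gA : <[g]>%g \subset <[a]>%g by rewrite cycle_subG.
  apply/eqP; rewrite (eq_subG_cyclic (cycle_cyclic a) cA gA).
  by rewrite -!orderE oc -gd inordK ?od_lt.
have ga : g \in <[a]>%g by rewrite -cycle_subG -cg.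
have gd : #[g]%g = d by rewrite [LHS]orderE -cg -orderE.
by split=> //; rewrite gd inord_val.
Qed.

Lemma quaternion_sum (V : zmodType) (f : nat -> V) :
  \sum_(g in G) f #[g]%g =
  f 4 *+ (2 * m) + \sum_(d < (2 * m).+1 | (d %| 2 * m)%N) f d *+ totient d.
Proof.
have [a [oa oG aG out]] := quaternion_structure.
rewrite (big_setID <[a]>%g) /= (finset.setIidPr aG) sum_cyclic_order oa addrC.
congr (_ + _); rewrite (eq_bigr (fun=> f 4)) => [|g]; last first.
  by rewrite inE => /andP[ga Gg]; rewrite out.
rewrite sumr_const cardsD (finset.setIidPr aG) oG -orderE oa.
by congr (_ *+ _); rewrite -mulnBl.
Qed.

End QuaternionGroup.

(** * Decision procedure for abelian groups *)

Inductive zexp := ZVar of nat | ZAdd of zexp & zexp | ZOpp of zexp | ZZero.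

Fixpoint zeval (V : zmodType) (s : seq V) (e : zexp) : V :=
  match e with
  | ZVar i => s`_i
  | ZAdd e1 e2 => zeval s e1 + zeval s e2
  | ZOpp e1 => - zeval s e1
  | ZZero => 0
  end.

Fixpoint zcoef (e : zexp) (i : nat) : int :=
  match e with
  | ZVar j => (i == j)%:Z
  | ZAdd e1 e2 => zcoef e1 i + zcoef e2 i
  | ZOpp e1 => - zcoef e1 i
  | ZZero => 0
  end.

Lemma zevalE (V : zmodType) (s : seq V) e :
  zeval s e = \sum_(i < size s) s`_i *~ zcoef e i.
Proof.
elim: e => [j|e1 IH1 e2 IH2|e IH|] /=.
- have [lt_js|le_sj] := ltnP j (size s).
    rewrite (bigD1 (Ordinal lt_js)) //= eqxx big1 ?addr0 //.
    by move=> i; rewrite -val_eqE /= => /negPf ->.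
  rewrite nth_default // big1 // => i _.
  by rewrite ltn_eqF // (leq_trans (ltn_ord i)).
- by rewrite IH1 IH2 -big_split; apply: eq_bigr => i _; rewrite mulrzDr.
- by rewrite IH -sumrN; apply: eq_bigr => i _; rewrite mulrNz.
- by rewrite big1.
Qed.

Lemma zexp_eq (V : zmodType) (s : seq V) e1 e2 :
  all (fun i => zcoef e1 i == zcoef e2 i) (iota 0 (size s)) ->
  zeval s e1 = zeval s e2.
Proof.
move=> /allP h; rewrite !zevalE; apply: eq_bigr => i _.
by rewrite (eqP (h i _)) // mem_iota add0n ltn_ord.
Qed.

(* Atoms are compared up to conversion: [linearB] and its variants leave
   distinct coercions around the same function. *)
Ltac z_mem x s :=
  lazymatch s with
  | nil => constr:(false)
  | ?y :: ?s' =>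
    let b := match constr:(tt) with
             | _ => let _ := constr:(erefl x : x = y) in constr:(true)
             | _ => constr:(false)
             end in
    lazymatch b with true => b | false => z_mem x s' end
  end.
Ltac z_index x s :=
  match s with
  | ?y :: _ => let _ := constr:(erefl x : x = y) in constr:(O)
  | _ :: ?s' => let i := z_index x s' in constr:(S i)
  end.
Ltac z_atoms t s :=
  lazymatch t with
  | (?a + ?b)%R => let s' := z_atoms a s in z_atoms b s'
  | (- ?a)%R => z_atoms a s
  | 0%R => s
  | _ => lazymatch z_mem t s with true => s | false => constr:(t :: s) end
  end.
Ltac z_quote t s :=
  lazymatch t with
  | (?a + ?b)%R =>
      let a' := z_quote a s in let b' := z_quote b s in constr:(ZAdd a' b')
  | (- ?a)%R => let a' := z_quote a s in constr:(ZOpp a')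
  | 0%R => constr:(ZZero)
  | _ => let i := z_index t s in constr:(ZVar i)
  end.
Ltac zmod :=
  lazymatch goal with
  | |- @eq ?V ?l ?r =>
      let s0 := z_atoms l (@nil V) in
      let s := z_atoms r s0 in
      let el := z_quote l s in
      let er := z_quote r s in
      exact (@zexp_eq V s el er isT)
  end.


(** * Homology of quotient complexes *)

Definition is_subspace (V : lmodType rat) (P : V -> Prop) :=
  P 0 /\ forall a x y, P x -> P y -> P (a *: x + y).

Section Subspace.
Variables (V : lmodType rat) (P : V -> Prop) (sP : is_subspace P).

Lemma subspace0 : P 0. Proof. by case: sP. Qed.

Lemma subspaceD x y : P x -> P y -> P (x + y).
Proof. by have [_ h] := sP => /h/[apply] /(_ 1); rewrite scale1r. Qed.

Lemma subspaceZ a x : P x -> P (a *: x).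
Proof. by have [h0 h] := sP => Px; rewrite -[_ *: _]addr0; exact: h. Qed.

Lemma subspaceN x : P x -> P (- x).
Proof. by rewrite -scaleN1r; exact: subspaceZ. Qed.

Lemma subspaceB x y : P x -> P y -> P (x - y).
Proof. by move=> Px /subspaceN; exact: subspaceD. Qed.

Lemma subspace_sum I (r : seq I) (F : I -> V) :
  (forall i, P (F i)) -> P (\sum_(i <- r) F i).
Proof.
by move=> PF; elim/big_ind: _ => //; [exact: subspace0|exact: subspaceD].
Qed.

End Subspace.

Section LinearCombination.
Variable V : lmodType rat.

Definition lincomb b (a : 'rV[rat]_b) (z : 'I_b -> V) := \sum_i a 0 i *: z i.

Lemma lincombD b (a a' : 'rV[rat]_b) z :
  lincomb (a + a') z = lincomb a z + lincomb a' z.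
Proof.
by rewrite /lincomb -big_split; apply: eq_bigr => i _; rewrite !mxE scalerDl.
Qed.

Lemma lincombB b (a a' : 'rV[rat]_b) z :
  lincomb (a - a') z = lincomb a z - lincomb a' z.
Proof.
by rewrite /lincomb -sumrB; apply: eq_bigr => i _; rewrite !mxE scalerBl.
Qed.

Lemma lincombZ b k (a : 'rV[rat]_b) z : lincomb (k *: a) z = k *: lincomb a z.
Proof.
by rewrite /lincomb scaler_sumr; apply: eq_bigr => i _; rewrite mxE scalerA.
Qed.

Lemma lincomb0 b (z : 'I_b -> V) : lincomb 0 z = 0.
Proof. by rewrite /lincomb big1 // => i _; rewrite mxE scale0r. Qed.

Lemma lincomb_mulmx b c (a : 'rV[rat]_c) (W : 'M[rat]_(c, b)) z :
  lincomb a (fun i => lincomb (row i W) z) = lincomb (a *m W) z.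
Proof.
rewrite /lincomb; under eq_bigr do rewrite scaler_sumr.
rewrite exchange_big; apply: eq_bigr => j _; rewrite mxE scaler_suml.
by apply: eq_bigr => i _; rewrite scalerA mxE.
Qed.

Lemma lincomb_diff b (a : 'rV[rat]_b) z z' :
  lincomb a z - lincomb a z' = lincomb a (fun i => z i - z' i).
Proof. by rewrite /lincomb -sumrB; apply: eq_bigr => i _; rewrite scalerBr. Qed.

Lemma subspace_lincomb (P : V -> Prop) (sP : is_subspace P) b
    (a : 'rV[rat]_b) z : (forall i, P (z i)) -> P (lincomb a z).
Proof. by move=> Pz; apply: subspace_sum => // i; apply: subspaceZ. Qed.

Lemma lincomb_split b c (a : 'rV[rat]_(b + c)) (y : 'I_b -> V) (z : 'I_c -> V) :
  lincomb a
    (fun i => match fintype.split i with inl j => y j | inr j => z j end) =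
  lincomb (lsubmx a) y + lincomb (rsubmx a) z.
Proof.
rewrite /lincomb big_split_ord /=; congr (_ + _); apply: eq_bigr => i _.
  by rewrite (unsplitK (inl i)) mxE.
by rewrite (unsplitK (inr i)) mxE.
Qed.

(** Coefficients are row vectors, so that an endomorphism induced on the quotient becomes a matrix
    acting on the right. *)
Definition quot_basis (Z B : V -> Prop) b (z : 'I_b -> V) :=
  [/\ forall i, Z (z i),
      forall c, Z c -> exists a : 'rV_b, B (c - lincomb a z)
    & forall a : 'rV_b, B (lincomb a z) -> a = 0].

End LinearCombination.

Lemma linear_lincomb (V W : lmodType rat) (f : {linear V -> W}) b
    (a : 'rV[rat]_b) z : f (lincomb a z) = lincomb a (fun i => f (z i)).
Proof.
by rewrite /lincomb linear_sum; apply: eq_bigr => i _; rewrite linearZ.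
Qed.

(* A window [X2 -> X1 -> X0] of a chain complex; [N'] is a subcomplex and
   [N = N' + im u], where [u] is a chain map, injective on the quotient by [N'].
   The long exact sequence splits the homology of [X / N] at [X1] into the
   cokernel of [u] at [X1] and the kernel of [u] at [X0]. *)
Section Wang.
Variables (X2 X1 X0 : lmodType rat).
Variables (d2 : {linear X2 -> X1}) (d1 : {linear X1 -> X0}).
Variables (u2 : {linear X2 -> X2}) (u1 : {linear X1 -> X1}).
Variables (u0 : {linear X0 -> X0}).
Variables (N1' N1 : X1 -> Prop) (N0' N0 Z0' : X0 -> Prop).
Hypothesis d1d2 : forall x, d1 (d2 x) = 0.
Hypothesis ud2 : forall x, u1 (d2 x) = d2 (u2 x).
Hypothesis ud1 : forall x, u0 (d1 x) = d1 (u1 x).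
Hypothesis sN1 : is_subspace N1'.
Hypothesis sN0 : is_subspace N0'.
Hypothesis dN : forall x, N1' x -> N0' (d1 x).
Hypothesis uN1 : forall x, N1' x -> N1' (u1 x).
Hypothesis uN0 : forall x, N0' x -> N0' (u0 x).
Hypothesis injN0 : forall x, N0' (u0 x) -> N0' x.
Hypothesis N1E : forall x, N1 x <-> exists f, N1' (x - u1 f).
Hypothesis N0E : forall x, N0 x <-> exists f, N0' (x - u0 f).
Hypothesis Z0'E : forall c f, N0' (d1 c - u0 f) -> Z0' f.

Let B1' c := exists e, N1' (c - d2 e).
Let B0' c := exists e, N0' (c - d1 e).
Let B1 c := exists e, N1 (c - d2 e).

Variables (b1 b0 : nat) (z1 : 'I_b1 -> X1) (z0 : 'I_b0 -> X0).
Hypothesis z1B : quot_basis (fun c => N0' (d1 c)) B1' z1.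
Hypothesis z0B : quot_basis Z0' B0' z0.
Variables (M1 : 'M[rat]_b1) (M0 : 'M[rat]_b0).
Hypothesis M1E : forall i, B1' (u1 (z1 i) - lincomb (row i M1) z1).
Hypothesis M0E : forall i, B0' (u0 (z0 i) - lincomb (row i M0) z0).

Let sB1' : is_subspace B1'.
Proof.
split; first by exists 0; rewrite linear0 subrr; exact: subspace0.
move=> a x y [e he] [f hf]; exists (a *: e + f).
rewrite linearP opprD addrACA -scalerBr.
by apply: subspaceD => //; exact: subspaceZ.
Qed.

Let sB0' : is_subspace B0'.
Proof.
split; first by exists 0; rewrite linear0 subrr; exact: subspace0.
move=> a x y [e he] [f hf]; exists (a *: e + f).
rewrite linearP opprD addrACA -scalerBr.
by apply: subspaceD => //; exact: subspaceZ.
Qed.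

Let u1_lincomb v : B1' (u1 (lincomb v z1) - lincomb (v *m M1) z1).
Proof.
by rewrite -lincomb_mulmx linear_lincomb lincomb_diff; exact: subspace_lincomb.
Qed.

Let u0_lincomb v : B0' (u0 (lincomb v z0) - lincomb (v *m M0) z0).
Proof.
by rewrite -lincomb_mulmx linear_lincomb lincomb_diff; exact: subspace_lincomb.
Qed.

(** As [u] acts on homology modulo [N'] by right multiplication, a complement of the row space of
    [M1] represents the cokernel, and the left kernel of [M0] is the kernel. *)
Let W1 := row_base (M1^C)%MS.
Let W0 := row_base (kermx M0).

Let kerW0 : W0 *m M0 = 0.
Proof. by apply/sub_kermxP; rewrite eq_row_base. Qed.

(** This inverts the connecting homomorphism: if [u0] kills the class of a chain, its value on that
    chain is a boundary [d1 y] modulo [N0'], and [y] is then a cycle modulo [N]. *)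
Let connecting (i : 'I_(\rank (kermx M0))) :
  exists y, N0' (d1 y - u0 (lincomb (row i W0) z0)).
Proof.
have := u0_lincomb (row i W0).
rewrite -row_mul kerW0 row0 lincomb0 subr0 => -[y hy].
by exists y; rewrite -[_ - _]opprB; exact: subspaceN.
Qed.

Lemma wang_quot_basis :
  exists z : 'I_(\rank (M1^C)%MS + \rank (kermx M0)) -> X1,
    quot_basis (fun c => N0 (d1 c)) B1 z.
Proof.
have [y hy] := fin_all_exists connecting.
have [z1Z z1gen z1free] := z1B; have [z0Z z0gen z0free] := z0B.
pose z1' i := lincomb (row i W1) z1.
pose z0' i := lincomb (row i W0) z0.
exists (fun i => match fintype.split i with inl j => z1' j | inr j => y j end).
have dlin v : N0' (d1 (lincomb v z1)).
  by rewrite linear_lincomb; exact: subspace_lincomb.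
have dy a : N0' (d1 (lincomb a y) - u0 (lincomb a z0')).
  by rewrite (linear_lincomb d1) (linear_lincomb u0) lincomb_diff;
    exact: subspace_lincomb.
split.
- move=> i; apply/N0E; case: (fintype.split i) => j; last by exists (z0' j).
  by exists 0; rewrite linear0 subr0; exact: dlin.
- move=> c /N0E[f hf].
  (* [f] represents the image of [c] under the connecting homomorphism. Correcting [c] by [u1 g] and
     by the chains [y] leaves a cycle modulo [N']. *)
  have [w [g hg]] := z0gen _ (Z0'E hf).
  have hu : N0' (d1 (c - u1 g) - u0 (lincomb w z0)).
    have := subspaceD sN0 hf (uN0 hg); rewrite !linearB /= ud1; congr N0'; zmod.
  have [a wE] : exists a, w = a *m W0.
    apply/submxP; rewrite eq_row_base; apply/sub_kermxP; apply: z0free.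
    have [e he] := u0_lincomb w; exists (c - u1 g - e).
    have := subspaceN sN0 (subspaceD sN0 hu he).
    rewrite ![d1 (_ - _)]linearB /=; congr N0'; zmod.
  have hc : N0' (d1 (c - u1 g - lincomb a y)).
    have := subspaceB sN0 hu (dy a).
    rewrite /z0' lincomb_mulmx wE ![d1 (_ - _)]linearB /=; congr N0'; zmod.
  have [v [e he]] := z1gen _ hc.
  (* The component of the class in the image of [M1] is, up to a boundary, a value of [u1], hence
     trivial modulo [N1]; only the complement [W1] remains. *)
  have full : (v <= col_mx W1 M1)%MS.
    rewrite -addsmxE (adds_eqmx (eq_row_base _) (eqmx_refl _)).
    by rewrite addsmxC; apply: submx_full; exact: addsmx_compl_full.
  have /submxP[p vE] := full.
  rewrite -[p]hsubmxK mul_row_col in vE.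
  exists (row_mx (lsubmx p) a).
  rewrite lincomb_split row_mxKl row_mxKr lincomb_mulmx.
  have [e' he'] := u1_lincomb (rsubmx p).
  exists (e - e'); apply/N1E; exists (g + lincomb (rsubmx p) z1).
  have := subspaceB sN1 he he'.
  rewrite vE lincombD (linearB d2) (linearD u1) /=; congr N1'; zmod.
- move=> a; rewrite lincomb_split lincomb_mulmx => -[e /N1E[f hf]].
  (* Applying [d1] and cancelling the injective [u0] shows that the combination of the [z0'] is a
     boundary, so the coefficients of the [y] vanish. *)
  have hd : N0' (u0 (lincomb (rsubmx a) z0' - d1 f)).
    have := subspaceB sN0 (dN hf)
      (subspaceD sN0 (dy (rsubmx a)) (dlin (lsubmx a *m W1))).
    rewrite !(linearB d1) !(linearD d1) !(linearB u0) /= d1d2 -ud1; congr N0';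
      zmod.
  have hr : rsubmx a = 0.
    have h0 : rsubmx a *m W0 = 0.
      by apply: z0free; exists f; rewrite -lincomb_mulmx; exact: injN0.
    apply: (row_free_inj (row_base_free _)); rewrite /= mul0mx; exact: h0.
  have hf' : N1' (lincomb (lsubmx a *m W1) z1 - d2 e - u1 f).
    by move: hf; rewrite hr lincomb0 addr0.
  (* By injectivity again [f] is a cycle modulo [N'], so the remaining relation puts
     [lsubmx a *m W1] in the row space of [M1], which meets its complement in 0. *)
  have [w [g hg]] : exists w, B1' (f - lincomb w z1).
    apply: z1gen; apply: injN0; rewrite ud1.
    have := subspaceB sN0 (dlin (lsubmx a *m W1)) (dN hf').
    rewrite !(linearB d1) /= d1d2; congr N0'; zmod.
  have /z1free/eqP : B1' (lincomb (lsubmx a *m W1 - w *m M1) z1).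
    have [h hh] := u1_lincomb w; exists (e + u2 g + h).
    have := subspaceD sN1 (subspaceD sN1 hf' (uN1 hg)) hh.
    rewrite lincombB !(linearB u1) !(linearD d2) /= ud2; congr N1'; zmod.
  rewrite subr_eq0 => /eqP hW.
  have h0 : lsubmx a *m W1 = 0.
    apply/eqP; rewrite -submx0 -(capmx_compl M1) sub_capmx {1}hW submxMl /=.
    by rewrite (submx_trans (submxMl _ _)) // eq_row_base.
  have hl : lsubmx a = 0.
    apply: (row_free_inj (row_base_free _)); rewrite /= mul0mx; exact: h0.
  by rewrite -[a]hsubmxK hl hr row_mx0.
Qed.

End Wang.

(** [c k] is the common dimension of the kernel and the cokernel of the endomorphism in degree [k];
    the quotient receives the cokernel in degree [k] and the kernel from degree [k - 1]. *)
Definition wang_betti (c : nat -> nat) k :=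
  (c k + if k is k'.+1 then c k' else 0)%N.

Section ChainComplex.
Variables (C : nat -> lmodType rat) (d : forall k, {linear C k.+1 -> C k}).

(* The complex is [C / N]; as in [is_cycle], there is nothing below degree 0. *)
Definition cycle_mod (N : forall k, C k -> Prop) k : C k -> Prop :=
  if k is k'.+1 then fun c => N k' (d k' c) else fun=> True.

Definition boundary_mod (N : forall k, C k -> Prop) k (c : C k) : Prop :=
  exists e, N k (c - d k e).

Definition has_homology_mod N (b : nat -> nat) :=
  forall k, exists z : 'I_(b k) -> C k,
    quot_basis (cycle_mod N (k:=k)) (boundary_mod N (k:=k)) z.

Lemma wang_homology (u : forall k, {linear C k -> C k})
    (N' N : forall k, C k -> Prop) (b : nat -> nat) :
  (forall k x, d k (d k.+1 x) = 0) ->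
  (forall k x, u k (d k x) = d k (u k.+1 x)) ->
  (forall k, is_subspace (N' k)) ->
  (forall k x, N' k.+1 x -> N' k (d k x)) ->
  (forall k x, N' k x -> N' k (u k x)) ->
  (forall k x, N' k (u k x) -> N' k x) ->
  (forall k x, N k x <-> exists f, N' k (x - u k f)) ->
  has_homology_mod N' b ->
  exists2 c : nat -> nat, (forall k, c k <= b k)%N &
    has_homology_mod N (wang_betti c).
Proof.
move=> dd ud sN dN uN injN NE hb.
pose z k := projT1 (cid (hb k)).
have zB k : quot_basis (cycle_mod N' (k:=k)) (boundary_mod N' (k:=k)) (z k).
  exact: (projT2 (cid (hb k))).
have uZ k x : cycle_mod N' x -> cycle_mod N' (u k x).
  by case: k x => [//|k] x /= ?; rewrite -ud; exact: uN.
have hM k : exists M : 'M[rat]_(b k), forall i,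
    boundary_mod N' (u k (z k i) - lincomb (row i M) (z k)).
  have [zZ zgen _] := zB k.
  have /fin_all_exists[M hM] : forall i, exists a : 'rV_(b k),
    boundary_mod N' (u k (z k i) - lincomb a (z k)).
    by move=> i; apply: zgen; exact: uZ.
  by exists (\matrix_i M i) => i; rewrite rowK.
pose M k := projT1 (cid (hM k)).
have ME k i : boundary_mod N' (u k (z k i) - lincomb (row i (M k)) (z k)).
  exact: (projT2 (cid (hM k))).
exists (fun k => \rank (kermx (M k))) => [k|k].
  by rewrite mxrank_ker leq_subr.
(* For a square matrix, kernel and cokernel have the same dimension; this is what makes the Euler
   characteristic telescope. *)
rewrite /wang_betti; have -> : \rank (kermx (M k)) = \rank ((M k)^C)%MS.
  by rewrite mxrank_ker mxrank_compl.
case: k => [|k].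
  (* Below degree 0 the window is completed by a copy of [C 0] in which every chain is read as zero,
     with the empty basis. *)
  have triv : quot_basis (fun=> True) (fun=> exists e : C 0, True)
      (fun i : 'I_0 => 0 : C 0).
    split=> // [c _|a _]; first by exists 0; exists 0.
    by apply/rowP => -[].
  have := @wang_quot_basis (C 1) (C 0) (C 0) (d 0) \0 (u 1) (u 0) \0
    (N' 0) (N 0) (fun=> True) (fun=> True) (fun=> True).
  move=> /(_ (fun=> erefl) (fun x => ud 0 x) (fun=> erefl) (sN 0)).
  move=> /(_ (conj I (fun _ _ _ _ _ => I)) (fun _ _ => I)).
  move=> /(_ (uN 0) (fun _ _ => I) (fun _ _ => I) (NE 0)).
  have h0 : forall x : C 0, True <-> exists f : C 0, True.
    by move=> x; split=> // _; exists 0.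
  move=> /(_ h0 (fun _ _ _ => I) _ _ _ _ (zB 0) triv (M 0) 0 (ME 0)).
  have h1 (i : 'I_0) : exists e : C 0, True by exists 0.
  move=> /(_ h1).
  have -> : \rank (kermx (0 : 'M[rat]_0)) = 0%N by rewrite mxrank_ker mxrank0.
  by [].
apply: (@wang_quot_basis _ _ _ _ _ (u k.+2) _ (u k) (N' k.+1) _ (N' k) _
  (cycle_mod N' (k:=k)) _ _ _ _ _ _ _ _ _ _ _ _ _ _ (z k.+1) (z k)) => //.
- exact: dN.
- exact: uN.
- exact: uN.
- exact: injN.
(* If [u f] equals a boundary [d c] modulo [N'], then [u (d f) = d (u f)] lies in [N'] because
   [d d c = 0], and injectivity makes [f] a cycle. *)
- case: k => [//|k] c f /= h.
  apply: injN; rewrite ud.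
  have := dN _ _ h; rewrite linearB /= dd sub0r => h'.
  by rewrite -[d _ _]opprK; apply: subspaceN.
- exact: ME.
- exact: ME.
Qed.

End ChainComplex.

Lemma wang_betti_euler (c : nat -> nat) K : c K = 0%N ->
  \sum_(k < K.+1) (-1) ^+ k * (wang_betti c k)%:Z = 0 :> int.
Proof.
suff -> : \sum_(k < K.+1) (-1) ^+ k * (wang_betti c k)%:Z =
    (-1) ^+ K * (c K)%:Z :> int by move=> ->; rewrite mulr0.
elim: K => [|K IH]; first by rewrite big_ord1 /wang_betti addn0.
rewrite big_ord_recr /= IH /wang_betti PoszD mulrDr exprS mulN1r !mulNr.
zmod.
Qed.

(** * Free modules *)

Section FreeModule.
Variable S : choiceType.
Local Notation F := {freeg S / rat}.

Lemma freegUZ (k : rat) (s : S) : << k *g s >> = k *: << s >> :> F.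
Proof.
by apply/eqP/freeg_eqP => x; rewrite coeffZ !coeffU mul1r.
Qed.

Lemma freeg_span (P : F -> Prop) :
  is_subspace P -> (forall s, P << s >>) -> forall c, P c.
Proof.
move=> sP PU; elim/freeg_ind_dom0 => [|k s c _ _ Pc]; first exact: subspace0.
by rewrite freegUZ; apply: subspaceD => //; exact: subspaceZ.
Qed.

Lemma fglift_is_linear (M : lmodType rat) (f : S -> M) : linear (fglift f).
Proof.
have fD : additive (fglift f) by exact: lift_is_additive.
have f0 : fglift f 0 = 0 by rewrite -(subrr 0) fD subrr.
have fN c : fglift f (- c) = - fglift f c by rewrite -[- c]sub0r fD f0 sub0r.
have fA c e : fglift f (c + e) = fglift f c + fglift f e.
  by rewrite -[e in LHS]opprK fD fN opprK.
move=> a c e; rewrite fA; congr (_ + _).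
elim/freeg_ind_dom0: c => [|k s c _ _ IH]; first by rewrite scaler0 f0 scaler0.
have -> : a *: (<< k *g s >> + c) = << a * k *g s >> + a *: c.
  by rewrite scalerDr (freegUZ (a * k)) (freegUZ k) scalerA.
by rewrite !fA IH !liftU scalerDr scalerA.
Qed.

HB.instance Definition _ (M : lmodType rat) (f : S -> M) :=
  GRing.isLinear.Build rat F M *:%R (fglift f) (fglift_is_linear f).

Lemma fgliftU (M : lmodType rat) (f : S -> M) s : fglift f << s >> = f s.
Proof. by rewrite liftU scale1r. Qed.

Lemma freeg_linear_ext (M : lmodType rat) (f g : {linear F -> M}) :
  (forall s, f << s >> = g << s >>) -> f =1 g.
Proof.
move=> fg; apply: freeg_span => // ; split=> [|a c e fc fe].
  by rewrite !linear0.
by rewrite !linearP fc fe.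
Qed.

End FreeModule.

Definition freeg_map (S S' : choiceType) (f : S -> S') :
  {freeg S / rat} -> {freeg S' / rat} := fglift (fun s => << f s >>).

HB.instance Definition _ (S S' : choiceType) (f : S -> S') :=
  GRing.Linear.on (freeg_map f).

Section FreeModuleMap.
Variables (S S' : choiceType) (f : S -> S').
Local Notation F := {freeg S / rat}.

Lemma freeg_mapU s : freeg_map f << s >> = << f s >>.
Proof. exact: fgliftU. Qed.

Lemma coeff_freeg_map_inj : injective f ->
  forall c s, coeff (f s) (freeg_map f c) = coeff s c.
Proof.
move=> f_inj c s; elim/freeg_ind_dom0: c => [|k t c _ _ IH].
  by rewrite linear0 !coeff0.
rewrite freegUZ linearD linearZ /= freeg_mapU !coeffD IH !coeffZ !coeffU.
by rewrite (inj_eq f_inj).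
Qed.

Lemma coeff_freeg_map_notin c s' : (forall s, f s <> s') ->
  coeff s' (freeg_map f c) = 0.
Proof.
move=> fs'; elim/freeg_ind_dom0: c => [|k t c _ _ IH].
  by rewrite linear0 !coeff0.
rewrite freegUZ linearD linearZ /= freeg_mapU !coeffD IH !coeffZ !coeffU.
by case: eqP => [/fs' //|]; rewrite !mulr0 addr0.
Qed.

Lemma freeg_map_surj : (forall s', exists s, f s = s') ->
  forall c', exists c, freeg_map f c = c'.
Proof.
move=> f_surj; apply: freeg_span => [|s'].
  split=> [|a x y [c <-] [e <-]]; first by exists 0; rewrite linear0.
  by exists (a *: c + e); rewrite linearP.
by have [s <-] := f_surj s'; exists << s >>; rewrite freeg_mapU.
Qed.

(** With [g] a section of [f] over its image, [c - freeg_map g (freeg_map f c)] is a combination of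
    differences of generators with equal image. An empty [S] is treated apart, as it offers no
    default value [s0]. *)
Lemma freeg_map_kernel (P : F -> Prop) : is_subspace P ->
  (forall s t, f s = f t -> P (<< s >> - << t >>)) ->
  forall c, freeg_map f c = 0 -> P c.
Proof.
move=> sP Pf c fc0.
have [s0|S0] := pselect (exists s0 : S, True); last first.
  suff -> : c = 0 by exact: subspace0.
  by apply: (freeg_span (P := fun c => c = 0)) => [|s];
    [split=> // a x y -> ->; rewrite scaler0 addr0 | case: S0; exists s].
have {s0} [s0 _] := cid s0.
have /choice[g fg] : forall s', exists s, (exists t, f t = s') -> f s = s'.
  move=> s'; have [[t <-]|h] := pselect (exists t, f t = s'); first by exists t.
  by exists s0.
suff : P (c - freeg_map g (freeg_map f c)) by rewrite fc0 linear0 subr0.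
move: c {fc0}; apply: freeg_span => [|s].
  split=> [|a x y Px Py]; first by rewrite !(linear0 (freeg_map _)) subr0;
    exact: subspace0.
  rewrite !(linearP (freeg_map _)) opprD addrACA -scalerBr.
  by apply: subspaceD => //; exact: subspaceZ.
rewrite freeg_mapU /freeg_map fgliftU; apply: Pf; rewrite fg //.
by exists s.
Qed.

End FreeModuleMap.

Lemma freeg_map_comp (S S' S'' : choiceType) (f : S -> S') (g : S' -> S'') c :
  freeg_map g (freeg_map f c) = freeg_map (g \o f) c.
Proof.
apply: (freeg_linear_ext (f := freeg_map g \o freeg_map f)) => s /=.
by rewrite !freeg_mapU.
Qed.

(* The coefficients of [freeg_map f c] are constant along the infinite orbits
   of [t], whereas its support is finite. *)
Lemma freeg_map_invariant (S S' : choiceType) (f : S -> S') (t : S' -> S') :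
  injective t ->
  (forall s i, iter i.+1 t (f s) <> f s) ->
  forall c, freeg_map t (freeg_map f c) = freeg_map f c -> freeg_map f c = 0.
Proof.
move=> t_inj nper c; set x := freeg_map f c => tx.
apply/eqP/freeg_eqP => s'; rewrite coeff0.
have [[s <-]|h] := pselect (exists s, f s = s'); last first.
  by apply: coeff_freeg_map_notin => s fs; apply: h; exists s.
apply/eqP; apply: contrapT => /negP xs.
have orb i : coeff (iter i t (f s)) x = coeff (f s) x.
  by elim: i => // i IH; rewrite -IH iterS -{1}tx coeff_freeg_map_inj.
have iter_inj i j : iter i t (f s) = iter j t (f s) -> i = j.
  have main p q : iter (p + q) t (f s) = iter p t (f s) -> q = 0%N.
    elim: p => [|p IH] /=; last by move=> /t_inj.
    by case: q => [//|q] /nper.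
  case: (leqP i j) => [/subnKC <- /esym/main ->|/ltnW/subnKC <- /main ->].
    by rewrite addn0.
  by rewrite addn0.
pose m := (size (dom x)).+1.
have sub : {subset [seq iter i t (f s) | i <- iota 0 m] <= dom x}.
  by move=> _ /mapP[i _ ->]; rewrite mem_dom orb.
suff /uniq_leq_size/(_ sub) : uniq [seq iter i t (f s) | i <- iota 0 m].
  by rewrite size_map size_iota ltnn.
by rewrite map_inj_uniq ?iota_uniq.
Qed.

(** * The singular complex *)

Section SingularComplex.
Variable R : realType.
Implicit Types X Y : topologicalType.

HB.instance Definition _ X k :=
  GRing.isLinear.Build rat (singular_chain R X k.+1) (singular_chain R X k)
    *:%R (@boundary R X k) (fglift_is_linear (@simplex_boundary R X k)).

Definition chainL X k : lmodType rat := singular_chain R X k.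

Definition boundaryL X k : {linear chainL X k.+1 -> chainL X k} :=
  @boundary R X k.

Lemma boundaryU X k (s : singular_simplex R X k.+1) :
  boundary << s >> = simplex_boundary s.
Proof. exact: fgliftU. Qed.

Definition push X Y (f : continuousType X Y) k (s : singular_simplex R X k) :
  singular_simplex R Y k := f \o s.

Lemma boundary_push X Y (f : continuousType X Y) k (c :
  singular_chain R X k.+1) :
  boundary (freeg_map (push f (k:=k.+1)) c) =
  freeg_map (push f (k:=k)) (boundary c).
Proof.
move: c; apply: (freeg_linear_ext (f := boundaryL Y k \o freeg_map _)
  (g := freeg_map _ \o boundaryL X k)) => s /=.
rewrite freeg_mapU !boundaryU /simplex_boundary linear_sum.
apply: eq_bigr => i _; rewrite linearZ /= freeg_mapU.
by congr (_ *: << _ >>); exact/continuousEP.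
Qed.

Lemma face_row_lift k (i : 'I_k.+2) (x : 'rV[R]_k.+1) j :
  face_row i x 0 (fintype.lift i j) = x 0 j.
Proof. by rewrite mxE liftK. Qed.

Lemma face_row_self k (i : 'I_k.+2) (x : 'rV[R]_k.+1) : face_row i x 0 i = 0.
Proof. by rewrite mxE unlift_none. Qed.

(** The simplicial identity in symmetric form: zeros are inserted at the distinct positions [i] and
    [i'] in either order, without deciding which is smaller. *)
Lemma face_row_swap k (i i' : 'I_k.+3) (j j' : 'I_k.+2) (x : 'rV[R]_k.+1) :
  i' = fintype.lift i j -> i = fintype.lift i' j' ->
  face_row i (face_row j x) = face_row i' (face_row j' x).
Proof.
move=> i'E iE; apply/rowP => l.
have [a ->|->] := unliftP i l; last first.
  by rewrite face_row_self iE face_row_lift face_row_self.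
rewrite face_row_lift.
have [b ->|->] := unliftP j a; last first.
  by rewrite -i'E !face_row_self.
rewrite face_row_lift.
suff -> : fintype.lift i (fintype.lift j b) = fintype.lift i' (fintype.lift j'
  b).
  by rewrite !face_row_lift.
have := congr1 val i'E; have := congr1 val iE => /=.
by move=> h h'; apply: val_inj => /=; rewrite /bump in h h' *; lia.
Qed.

(** This gives opposite signs to the two orders of omitting a pair of vertices. *)
Lemma bump_swap i i' j j' : i' = bump i j -> i = bump i' j' ->
  (i' + j' = (i + j).+1 \/ i + j = (i' + j').+1)%N.
Proof. rewrite /bump; lia. Qed.

Lemma boundary_boundary X k (c : singular_chain R X k.+2) :
  boundary (boundary c) = 0.
Proof.
move: c; apply: (freeg_linear_ext (f := boundaryL X k \o boundaryL X k.+1)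
  (g := \0)) => s /=.
rewrite boundaryU {1}/simplex_boundary linear_sum /=.
pose t (i : 'I_k.+3) (j : 'I_k.+2) : singular_chain R X k :=
  (-1) ^+ (i + j) *:
  << s \o @face R k.+1 i \o @face R k j : singular_simplex R X k >>.
(* Indexing by the pair of omitted vertices, with zero diagonal, makes the summand antisymmetric, so
   the double sum is its own opposite and vanishes over the rationals. *)
pose A i i' := if unlift i i' is Some j then t i j else 0.
rewrite (eq_bigr (fun i => \sum_i' A i i')) => [|i _]; last first.
  rewrite linearZ /= boundaryU /simplex_boundary scaler_sumr.
  rewrite [RHS](bigD1_ord i) //= {1}/A unlift_none add0r.
  by apply: eq_bigr => j _; rewrite /A liftK /t scalerA exprD.
set S := \sum_i _.
have AN i i' : A i' i = - A i i'.
  rewrite /A; case: unliftP => [j' iE|->]; last by rewrite unlift_none oppr0.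
  case: unliftP => [j i'E|i'E]; last first.
    by have := neq_lift i' j'; rewrite -iE i'E eqxx.
  rewrite /t -scaleNr; congr (_ *: << _ >>); last first.
    apply/continuousEP => x; congr (s _); apply: eq_exist.
    by rewrite !set_valE /= (face_row_swap _ i'E iE).
  have [->|->] := bump_swap (congr1 val i'E) (congr1 val iE).
  - by rewrite exprS mulN1r.
  - by rewrite exprS mulN1r opprK.
have : S = - S.
  rewrite {1}/S exchange_big /= -sumrN; apply: eq_bigr => i _.
  by rewrite -sumrN; apply: eq_bigr => i' _; rewrite AN.
move=> /eqP; rewrite -addr_eq0 -mulr2n -scaler_nat scaler_eq0.
by rewrite pnatr_eq0 => /eqP.
Qed.

End SingularComplex.

Local Open Scope classical_set_scope.

(** * Topology of the standard simplex *)

Lemma cvg_mx (T : Type) (F : set_system T) (V : topologicalType) m n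
    (f : T -> 'M[V]_(m, n)) (A : 'M[V]_(m, n)) : Filter F ->
  (forall i j, f x i j @[x --> F] --> A i j) -> f @ F --> A.
Proof.
move=> FF fA U [P AP PU].
have : \forall x \near F, forall i j, P i j (f x i j).
  apply: filter_forall => i; apply: filter_forall => j.
  exact: (fA i j _ (AP i j)).
by apply: filterS => x; exact: PU.
Qed.

Lemma continuous_to_set_type (T X : topologicalType) (A : set X)
    (f : T -> A) x :
  {for x, continuous (set_val \o f)} -> {for x, continuous f}.
Proof.
move=> cf U [_ [[W oW <-] /= Wfx]] /filterS; apply; apply: cf.
exact: open_nbhs_nbhs.
Qed.

Lemma set_val_continuous (X : topologicalType) (A : set X) :
  continuous (set_val : A -> X).
Proof. exact: initial_continuous. Qed.

Lemma set_type_eq (X : Type) (A : set X) (x y : A) :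
  set_val x = set_val y -> x = y.
Proof. by rewrite !set_valE; exact: val_inj. Qed.

Lemma near_set_val (X : topologicalType) (A : set X) (x : A) (P : A -> Prop) :
  (\forall y \near x, P y) ->
  \forall v \near set_val x, forall Av : v \in A, P (exist _ v Av).
Proof.
move=> [_ [[W oW <-] /= Wx] WP].
have : nbhs (set_val x) W by exact: open_nbhs_nbhs.
by apply: filterS => v Wv Av; apply: WP.
Qed.

Section Simplex.
Variables (R : realType) (k : nat).
Local Notation Delta := (std_simplex R k).

Lemma std_simplex_ge0 (x : Delta) i : 0 <= set_val x 0 i.
Proof. by have [+ _] := set_valP x. Qed.

Lemma std_simplex_sum (x : Delta) : \sum_i set_val x 0 i = 1.
Proof. by have [_ +] := set_valP x. Qed.

Lemma std_simplex_le1 (x : Delta) i : set_val x 0 i <= 1.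
Proof.
rewrite -(std_simplex_sum x) (bigD1 i) //= lerDl.
by apply: sumr_ge0 => j _; exact: std_simplex_ge0.
Qed.

Lemma std_simplex_coord_continuous i : continuous (fun x : Delta =>
  set_val x 0 i).
Proof.
move=> x; apply: (continuous_comp (f := set_val) (g := fun v :
  'rV[R]_k.+1 => v 0 i)).
  exact: set_val_continuous.
exact: coord_continuous.
Qed.

Lemma std_simplex_compact : compact Delta.
Proof.
have box : compact [set v : 'rV[R]_k.+1 | forall i, `[0, 1]%classic (v 0 i)].
  by apply: (@rV_compact R k.+1 (fun=> `[0, 1]%classic)) => _;
    exact: segment_compact.
apply: subclosed_compact box _; last first.
  move=> x [x0 x1] i; rewrite /= in_itv /= x0 /= -x1 (bigD1 i) //= lerDl.
  by apply: sumr_ge0 => j _; exact: x0.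
have -> : Delta = [set x : 'rV[R]_k.+1 | \sum_i x 0 i = 1] `&`
    \bigcap_(i in [set: 'I_k.+1]) [set x : 'rV[R]_k.+1 | 0 <= x 0 i].
  apply/seteqP; split=> x /=; first by move=> [x0 x1]; split=> // i _;
    exact: x0.
  by move=> [x1 x0]; split=> [i|//]; exact: (x0 i).
apply: closedI.
  apply: (preimage_closed (f := fun x : 'rV[R]_k.+1 =>
    \sum_i x 0 i) _ (@closed_eq _ 1)).
  move=> x _; apply: continuous_big => [|i _]; first exact: add_continuous.
  exact: coord_continuous.
apply: closed_bigI => i _.
apply: (preimage_closed (f := fun x : 'rV[R]_k.+1 =>
  x 0 i) _ (@closed_ge _ 0)) => x _.
exact: coord_continuous.
Qed.

(** The tube lemma for the compact simplex, used for the continuity of cones at the apex and for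
    Lebesgue numbers. [Q] moves the predicate to the ambient space, where compactness is stated. *)
Lemma std_simplex_near_covering (I : Type) (F : set_system I) (FF : Filter F)
    (P : I -> Delta -> Prop) :
  (forall x : Delta, exists U V,
     [/\ nbhs x U, F V & forall x' i, U x' -> V i -> P i x']) ->
  \forall i \near F, forall x, P i x.
Proof.
move=> hP.
pose Q i (v : 'rV[R]_k.+1) := forall Dv : v \in Delta, P i (exist _ v Dv).
have /compact_near_coveringP/near_covering_withinP := std_simplex_compact.
move=> /(_ I F Q FF) h.
suff : \forall i \near F, Delta `<=` Q i.
  apply: filterS => i h' x; case: x => v Dv; apply: h'; exact/set_mem.
apply: h => v /mem_set Dv.
have [U [V [Uv FV UVP]]] := hP (exist _ v Dv).
have : \forall w \near v, forall Dw : w \in Delta, U (exist _ w Dw).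
  exact: (near_set_val (x := exist _ v Dv) (P := U)).
move=> hU; exists ([set w | forall Dw :
  w \in Delta, U (exist _ w Dw)], V) => //=.
by move=> [w i] /= [Uw Vi] _ Dw; apply: UVP.
Qed.

End Simplex.

(* The projection of the simplex from its vertex 0 onto the opposite face;
   its value at that vertex is irrelevant. *)
Definition collapse_row (R : realType) k (y : 'rV[R]_k.+2) : 'rV[R]_k.+1 :=
  if y 0 0 == 1 then delta_mx 0 0
  else \row_j (y 0 (fintype.lift 0 j) / (1 - y 0 0)).

Lemma collapse_row_simplex (R : realType) k (y : std_simplex R k.+1) :
  collapse_row (set_val y) \in std_simplex R k.
Proof.
apply/mem_set; rewrite /collapse_row; case: eqP => [_|/eqP y1]; split=> [i|].
- by rewrite mxE ler0n.
- rewrite (bigD1 0) //= big1 ?addr0 ?mxE ?eqxx // => i i0.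
  by rewrite mxE (negPf i0).
- by rewrite mxE divr_ge0 ?subr_ge0 ?std_simplex_le1 ?std_simplex_ge0.
- have := std_simplex_sum y; rewrite big_ord_recl => /(canRL (addKr _)).
  rewrite addrC => ySum; under eq_bigr do rewrite mxE.
  by rewrite -mulr_suml ySum divff // subr_eq0 eq_sym.
Qed.

Definition collapse (R : realType) k (y : std_simplex R k.+1) :
  std_simplex R k :=
  exist _ (collapse_row (set_val y)) (collapse_row_simplex y).

Lemma set_val_exist (T : Type) (A : set T) x (Ax : x \in A) :
  set_val (exist _ x Ax : A) = x.
Proof. by rewrite set_valE. Qed.

Lemma set_val_collapse (R : realType) k (y : std_simplex R k.+1) :
  set_val (collapse y) = collapse_row (set_val y).
Proof. exact: set_val_exist. Qed.

Lemma set_val_face (R : realType) k i (x : std_simplex R k) :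
  set_val (face i x) = face_row i (set_val x).
Proof. exact: set_val_exist. Qed.

Lemma collapse_continuous (R : realType) k (y : std_simplex R k.+1) :
  set_val y 0 0 != 1 -> {for y, continuous (@collapse R k)}.
Proof.
move=> y1; apply: continuous_to_set_type.
apply: (cvg_mx (F := nbhs y)) => i j.
have c0 := @std_simplex_coord_continuous R k.+1 0.
have near1 : nbhs y [set x : std_simplex R k.+1 | set_val x 0 0 != 1].
  have /= := c0 y _ (open_nbhs_nbhs (conj (@open_neq R 1) y1)).
  by [].
apply: (@cvg_trans _
  ((fun x : std_simplex R k.+1 =>
    set_val x 0 (fintype.lift 0 j) / (1 - set_val x 0 0)) @ y)).
  apply: near_eq_cvg; near=> x => /=;
    rewrite set_val_collapse /collapse_row ifF ?mxE //.
  by apply/negbTE; near: x.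
rewrite /= set_val_collapse /collapse_row (negPf y1) mxE.
apply: (cvgM (F := nbhs y)); first exact: std_simplex_coord_continuous.
apply: (cvgV (F := nbhs y)); first by rewrite subr_eq0 eq_sym.
by apply: (cvgB (F := nbhs y)); [exact: cvg_cst|exact: c0].
Unshelve. all: by end_near. Qed.

(** * Cones and the homology of a contractible space *)

Section Cone.
Variables (R : realType) (E : topologicalType) (H : R -> E -> E) (p : E).
Hypothesis H_continuous : continuous (fun z : R * E => H z.1 z.2).
Hypothesis H0 : forall x, H 0 x = p.
Hypothesis H1 : forall x, H 1 x = x.
Local Notation simplex := (singular_simplex R E).

Definition cone_fun k (s : simplex k) (y : std_simplex R k.+1) : E :=
  H (1 - set_val y 0 0) (s (collapse y)).

(** [collapse] need not be continuous at vertex 0, but there the parameter of [H] is 0, and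
    [H t (s x)] tends to [p] uniformly in [x] by compactness. *)
Lemma cone_continuous k (s : simplex k) : continuous (cone_fun s).
Proof.
move=> y.
have c0 : (fun x : std_simplex R k.+1 => 1 - set_val x 0 0) @ y
    --> 1 - set_val y 0 0.
  by apply: (cvgB (F := nbhs y));
    [exact: cvg_cst|exact: std_simplex_coord_continuous].
have [y1|y1] := eqVneq (set_val y 0 0) 1; last first.
  have c1 : (s \o @collapse R k) @ y --> s (collapse y).
    apply: (continuous_comp (x := y)); first exact: collapse_continuous.
    exact: cts_fun.
  exact: (continuous2_cvg (F := nbhs y) _
    (@H_continuous (1 - set_val y 0 0, s (collapse y))) c0 c1).
move=> U; rewrite /cone_fun y1 subrr H0 => Up.
have tube : \forall t \near (0 : R), forall x, U (H t (s x)).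
  apply: (@std_simplex_near_covering R k R (nbhs (0 : R)) _
    (fun t x => U (H t (s x)))) => x.
  have /= := @H_continuous (0, s x) U; rewrite H0 => /(_ Up).
  move=> [[V W] /= [V0 Wsx] VW].
  exists (s @^-1` W), V; split=> // [|x' t Wx' Vt].
    exact: (@cts_fun _ _ s x W Wsx).
  exact: (VW (t, s x')).
rewrite y1 subrr in c0.
by apply: (filterS (F := nbhs y) _ (c0 _ tube)) => x /= Ux; exact: Ux.
Qed.

Definition cone k (s : simplex k) :
  simplex k.+1 := mkcts (@cone_continuous k s).

Lemma cone_face0 k (s : simplex k) :
  cone s \o @face R k 0 = s :> simplex k.
Proof.
apply/continuousEP => x; rewrite /= /mkcts /cone_fun.
have x0 : set_val (face 0 x) 0 0 = 0 by rewrite set_val_face face_row_self.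
rewrite x0 subr0 H1; congr (s _); apply: set_type_eq; rewrite set_val_collapse.
apply/rowP => j; rewrite /collapse_row x0 eq_sym oner_eq0 subr0 mxE divr1.
by rewrite set_val_face face_row_lift.
Qed.

Lemma face_row_lift0 k i (x : 'rV[R]_k.+1) :
  face_row (fintype.lift 0 i) x 0 0 = x 0 0.
Proof.
rewrite [X in face_row _ _ _ X = _](_ : _ = fintype.lift (fintype.lift 0 i) 0).
  exact: face_row_lift.
exact: val_inj.
Qed.

Lemma cone_face k (s : simplex k.+1) i :
  cone s \o @face R k.+1 (fintype.lift 0 i) =
  cone (s \o @face R k i : simplex k) :> simplex k.+1.
Proof.
apply/continuousEP => x; rewrite /= /mkcts /cone_fun.
have x0 : set_val (face (fintype.lift 0 i) x) 0 0 = set_val x 0 0.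
  by rewrite set_val_face face_row_lift0.
rewrite x0; have [->|x1] := eqVneq (set_val x 0 0) 1;
  first by rewrite subrr !H0.
congr (H _ (s _)); apply: set_type_eq.
rewrite set_val_collapse !set_val_face set_val_collapse.
apply/rowP => j; rewrite /collapse_row face_row_lift0 (negPf x1) mxE.
have [j' ->|->] := unliftP i j.
  rewrite [in RHS]face_row_lift [in RHS]mxE; congr (_ / _).
  have -> : fintype.lift 0 (fintype.lift i j') =
      fintype.lift (fintype.lift 0 i) (fintype.lift 0 j').
    by apply: val_inj; rewrite /= /bump /= !add1n ltnS addnS.
  exact: face_row_lift.
by rewrite !face_row_self mul0r.
Qed.

Definition apex : simplex 0 := cst p.

Lemma cone_face_apex (s : simplex 0) :
  cone s \o @face R 0 (fintype.lift 0 0) = apex :> simplex 0.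
Proof.
apply/continuousEP => x; rewrite /= /mkcts /cone_fun.
have -> : set_val (face (fintype.lift 0 0) x) 0 0 = 1.
  rewrite set_val_face face_row_lift0 -(std_simplex_sum x) big_ord1.
  by congr (set_val x _ _); exact: val_inj.
by rewrite subrr H0.
Qed.

Local Notation chain := (singular_chain R E).

(** Face 0 of a cone is its base and the other faces are cones over the faces of the base, so coning
    is a contracting homotopy in positive degrees; in degree 0 the [apex] remains. *)
Lemma boundary_cone k (c : chain k.+1) :
  boundary (freeg_map (@cone k.+1) c) = c - freeg_map (@cone k) (boundary c).
Proof.
move: c; apply: (freeg_linear_ext (f := boundaryL R E k.+1 \o freeg_map (@cone
  k.+1))
  (g := idfun \- (freeg_map (@cone k) \o boundaryL R E k))) => s /=.
rewrite freeg_mapU !boundaryU /simplex_boundary big_ord_recl expr0 scale1r.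
rewrite cone_face0; congr (_ + _).
rewrite linear_sum -sumrN; apply: eq_bigr => i _.
by rewrite linearZ /= freeg_mapU exprS mulN1r scaleNr cone_face.
Qed.

Lemma boundary_cone0 (s : simplex 0) :
  boundary << cone s >> = << s >> - << apex >> :> chain 0.
Proof.
rewrite boundaryU /simplex_boundary big_ord_recl big_ord1 expr0 scale1r.
by rewrite cone_face0 cone_face_apex expr1 scaleN1r.
Qed.

(** This is the augmentation; it shows that no nonzero multiple of [apex] is a boundary. *)
Lemma augmentation_boundary (X : topologicalType) (c : singular_chain R X 1) :
  fglift (fun=> 1 : rat^o) (boundary c) = 0.
Proof.
move: c; apply: (freeg_linear_ext
  (f := fglift (fun=> 1 : rat^o) \o boundaryL R X 0) (g := \0)) => s /=.
rewrite boundaryU /simplex_boundary big_ord_recl big_ord1 linearD !linearZ /=.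
by rewrite !fgliftU expr0 expr1 scale1r scaleN1r subrr.
Qed.

Lemma cone_homology :
  has_homology_mod (C := chainL R E) (boundaryL R E) (fun _ c =>
    c = 0) (fun k => (k == 0)%N).
Proof.
case=> [|k] /=; last first.
  exists (fun i : 'I_0 => 0); split=> [[]//|c /= c0|a _];
    last by apply/rowP => -[].
  have := boundary_cone c; rewrite (c0 : boundary c = 0) linear0 subr0 => h.
  exists 0, (freeg_map (@cone k.+1) c); rewrite lincomb0 subr0.
  by apply/eqP; rewrite subr_eq0; apply/eqP; exact: esym h.
exists (fun i : 'I_1 => << apex >>); split=> [//|c _|a [e]].
  apply: (freeg_span (P := fun c : chainL R E 0 =>
    exists a : 'rV_1, boundary_mod
    (boundaryL R E) (fun _ c => c = 0) (c - lincomb a (fun=> << apex >>)))).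
    split; first by exists 0, 0; rewrite lincomb0 linear0 !subr0.
    move=> a x y [a1 [e1 h1]] [a2 [e2 h2]].
    exists (a *: a1 + a2), (a *: e1 + e2).
    rewrite lincombD lincombZ (linearP (boundaryL R E 0)).
    transitivity (a *: (x - lincomb a1 (fun=> << apex >>) - boundaryL R E 0 e1)
      + (y - lincomb a2 (fun=> << apex >>) - boundaryL R E 0 e2)).
      rewrite !scalerBr; zmod.
    by rewrite h1 h2 scaler0 addr0.
  move=> s; exists 1, << cone s >>.
  rewrite /lincomb big_ord1 mxE eqxx scale1r.
  by apply/eqP; rewrite subr_eq0; apply/eqP; exact: esym (boundary_cone0 s).
move=> /eqP; rewrite subr_eq0 /lincomb big_ord1 => /eqP h.
have := augmentation_boundary e; rewrite -h linearZ /= fgliftU.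
rewrite /= [_ *: _]mulr1 => a0.
by apply/rowP => i; rewrite ord1 a0 mxE.
Qed.

End Cone.

(** * Singular chains modulo a group of translations *)

Section Translations.
Variables (R : realType) (K : numFieldType) (E : normedModType K).
Local Notation simplex := (singular_simplex R E).
Local Notation chain := (chainL R E).

Lemma translation_continuous (v : E) : continuous (fun x : E => v + x).
Proof. by move=> x; apply: cvgD; [exact: cvg_cst|exact: cvg_id]. Qed.

Definition translate (v : E) k (s : simplex k) : simplex k :=
  push (mkcts (@translation_continuous v)) s.

Lemma translateE v k (s : simplex k) x : translate v s x = v + s x.
Proof. by []. Qed.

Lemma translateD v w k (s : simplex k) :
  translate v (translate w s) = translate (v + w) s.
Proof. by apply/continuousEP => x; rewrite !translateE addrA. Qed.

Lemma translate0 k (s : simplex k) : translate 0 s = s.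
Proof. by apply/continuousEP => x; rewrite translateE add0r. Qed.

Lemma iter_translate w k (s : simplex k) i :
  iter i (translate w (k:=k)) s = translate (w *+ i) s.
Proof.
elim: i => [|i IH]; first by rewrite mulr0n translate0.
by rewrite iterS IH translateD mulrS.
Qed.

Lemma translate_inj v k : injective (translate v (k:=k)).
Proof.
move=> s t /(congr1 (translate (- v) (k:=k))).
by rewrite !translateD addNr !translate0.
Qed.

Lemma std_simplex_inhabited k : std_simplex R k.
Proof.
exists (delta_mx 0 0); apply/mem_set; split=> [i|].
  by rewrite mxE ler0n.
by rewrite (bigD1 0) //= big1 ?addr0 ?mxE ?eqxx // => i i0;
  rewrite mxE (negPf i0).
Qed.

Lemma eq_translate v w k (s : simplex k) :
  translate v s = translate w s -> v = w.
Proof.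
move=> /continuousEP/(_ (std_simplex_inhabited k)).
by rewrite !translateE; exact: addIr.
Qed.

Definition subgroup (A : E -> Prop) :=
  A 0 /\ forall x y, A x -> A y -> A (x - y).

(** Orbits stand for the simplices of [E / A], so that no quotient space is formed for the
    intermediate groups. *)
Definition translates (A : E -> Prop) k (s : simplex k) : set (simplex k) :=
  [set s' | exists2 v, A v & s' = translate v s].

(* The kernel of the map induced by [E -> E / A] on singular chains, when
   [A] is discrete. *)
Definition translates_kernel (A : E -> Prop) k (c : chain k) : Prop :=
  freeg_map (translates A (k:=k)) c = 0.

Lemma translates_kernel_subspace A k : is_subspace (translates_kernel A (k:=k)).
Proof.
split=> [|a x y hx hy]; first exact: linear0.
rewrite /translates_kernel in hx hy *.
by rewrite linearP /= hx hy scaler0 addr0.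
Qed.

Section OneSubgroup.
Variables (A : E -> Prop) (gA : subgroup A).

Lemma subgroupN x : A x -> A (- x).
Proof. by have [A0 AB] := gA => /(AB 0 _ A0); rewrite sub0r. Qed.

Lemma subgroupD x y : A x -> A y -> A (x + y).
Proof.
by have [_ AB] := gA => Ax /subgroupN/(AB _ _ Ax); rewrite opprK.
Qed.

Lemma translates_translate v k (s : simplex k) : A v ->
  translates A (translate v s) = translates A s.
Proof.
move=> Av; apply/seteqP; split=> s' [w Aw ->].
  by exists (w + v); [exact: subgroupD|rewrite translateD].
exists (w - v); first by apply: subgroupD => //; exact: subgroupN.
by rewrite translateD subrK.
Qed.

Lemma translates_eq k (s t : simplex k) :
  translates A s = translates A t -> exists2 v, A v & s = translate v t.
Proof.
have [A0 _] := gA; move=> e; suff : translates A t s by [].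
by rewrite -e; exists 0; rewrite ?translate0.
Qed.

Lemma translates_kernel_span (k : nat) (P : chain k -> Prop) : is_subspace P ->
  (forall v t, A v -> P (<< translate v t >> - << t >>)) ->
  forall c, translates_kernel A c -> P c.
Proof.
move=> sP PA; apply: freeg_map_kernel => // s t /translates_eq[v Av ->].
exact: PA.
Qed.

Lemma translates_kernel_translate v k (c : chain k) : A v ->
  translates_kernel A (freeg_map (translate v (k:=k)) c - c).
Proof.
move=> Av; rewrite /translates_kernel linearB /= freeg_map_comp.
apply/eqP; rewrite subr_eq0; apply/eqP.
move: c; apply: (freeg_linear_ext (f := freeg_map _) (g := freeg_map _)) => s.
by rewrite /= !freeg_mapU /= translates_translate.
Qed.

Lemma translates_kernel_translateU v k (s : simplex k) : A v ->
  translates_kernel A (<< translate v s >> - << s >> : chain k).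
Proof.
by move=> Av; have := translates_kernel_translate (k:=k) << s >> Av;
  rewrite freeg_mapU.
Qed.

Lemma translates_kernel_boundary k (c : chain k.+1) :
  translates_kernel A c -> translates_kernel A (boundaryL R E k c).
Proof.
apply: (translates_kernel_span
  (P := fun c : chain k.+1 => translates_kernel A (boundaryL R E k c))).
  split=> [|a x y hx hy].
    by rewrite linear0; exact: subspace0 (translates_kernel_subspace _ _).
  by rewrite linearP; have [_ h] := translates_kernel_subspace A k; exact: h.
move=> v t Av; rewrite linearB /=.
have := translates_kernel_translate (boundary << t >>) Av.
by rewrite -boundary_push freeg_mapU.
Qed.

End OneSubgroup.

Definition adjoin (A : E -> Prop) (w : E) (x : E) :=
  exists j : int, A (x - w *~ j).

Lemma adjoin_subgroup A w : subgroup A -> subgroup (adjoin A w).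
Proof.
move=> gA; have [A0 AB] := gA; split.
  by exists 0; rewrite mulr0z subr0.
move=> x y [i Ai] [j Aj]; exists (i - j).
have := AB _ _ Ai Aj; congr A; rewrite mulrzBr; zmod.
Qed.

Section Adjoin.
Variables (A : E -> Prop) (w : E).
Hypothesis gA : subgroup A.
Hypothesis wA : forall j : int, A (w *~ j) -> j = 0.

Definition shift k : {linear chain k -> chain k} :=
  freeg_map (translate w (k:=k)) \- idfun.

Lemma shiftE k c : shift k c = freeg_map (translate w (k:=k)) c - c.
Proof. by []. Qed.

Let image k (O : set (simplex k)) : set (simplex k) := translate w (k:=k) @` O.

Let translates_image k (s : simplex k) :
  translates A (translate w s) = image (translates A s).
Proof.
apply/seteqP; split=> t.
  move=> [v Av ->]; exists (translate v s); first by exists v.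
  by rewrite !translateD addrC.
by move=> [_ [v Av ->] <-]; exists v => //; rewrite !translateD addrC.
Qed.

Let freeg_map_image k (c : chain k) :
  freeg_map (translates A (k:=k)) (freeg_map (translate w (k:=k)) c) =
  freeg_map (@image k) (freeg_map (translates A (k:=k)) c).
Proof.
rewrite !freeg_map_comp.
move: c; apply: (freeg_linear_ext (f := freeg_map _) (g := freeg_map _)) => s.
by rewrite /= !freeg_mapU /= translates_image.
Qed.

Lemma shift_orbit_kernel k (c : chain k) :
  translates_kernel A c -> translates_kernel A (shift k c).
Proof.
move=> hc; rewrite shiftE /translates_kernel linearB /= freeg_map_image hc.
by rewrite linear0 subrr.
Qed.

(** No nonzero multiple of [w] lies in [A], so translation by [w] moves each [A]-orbit of simplices
    through infinitely many distinct ones, and an invariant chain of orbits is 0. *)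
Lemma shift_inj k (c : chain k) :
  translates_kernel A (shift k c) -> translates_kernel A c.
Proof.
rewrite shiftE /translates_kernel linearB /= freeg_map_image => /eqP.
rewrite subr_eq0 => /eqP; apply: freeg_map_invariant.
  have sub O O' : image O = image O' -> O `<=` O'.
    move=> e t Ot; have : image O (translate w t) by exists t.
    by rewrite e => -[t' O't' /translate_inj <-].
  by move=> O O' e; apply/seteqP; split; apply: sub.
move=> s i.
have -> : iter i.+1 (@image k) (translates A s) = translates A (translate (w *+
  i.+1) s).
  rewrite -iter_translate; elim: i.+1 => // j IH.
  by rewrite iterS IH -translates_image.
move=> /(translates_eq gA)[v Av /eq_translate e].
by have := wA (j := i.+1); rewrite -pmulrn e => /(_ Av).
Qed.

(** The [j]-th power of a translation minus 1 is divisible by the translation minus 1; a negative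
    [j] reduces to a positive one applied to the translated simplex. *)
Let translate_shift k (t : simplex k) (j : int) :
  exists f, << translate (w *~ j) t >> - << t >> = shift k f.
Proof.
have nat_case (m : nat) (s : simplex k) :
    exists f, << translate (w *+ m) s >> - << s >> = shift k f.
  elim: m => [|m [f hf]].
    by exists 0; rewrite mulr0n translate0 subrr linear0.
  exists (<< translate (w *+ m) s >> + f); rewrite (linearD (shift k)) -hf.
  rewrite shiftE freeg_mapU translateD -mulrS; zmod.
case: j => m; first by rewrite -pmulrn; exact: nat_case.
have [f hf] := nat_case m.+1 (translate (w *~ Negz m) t).
exists (- f); rewrite (linearN (shift k)) -hf translateD.
rewrite NegzE mulrNz -pmulrn subrr translate0; zmod.
Qed.

(** The kernel for the larger group is spanned by differences along [a + w *~ j] with [a] in [A]: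
    the move along [a] is trivial modulo [A], and the move along [w *~ j] is a value of [shift]. *)
Lemma translates_kernel_adjoin k (c : chain k) :
  translates_kernel (adjoin A w) c <-> exists f,
    translates_kernel A (c - shift k f).
Proof.
have gAw := adjoin_subgroup w gA; have [A0 _] := gA.
have sN B := translates_kernel_subspace B k.
split; last first.
  move=> [f hf].
  have wAw : adjoin A w w by exists 1; rewrite mulr1z subrr.
  have h1 : translates_kernel (adjoin A w) (c - shift k f).
    apply: (translates_kernel_span gA (P := translates_kernel (adjoin A w)
      (k:=k))) hf => //.
    move=> v t Av; apply: translates_kernel_translateU => //.
    by exists 0; rewrite mulr0z subr0.
  have := subspaceD (sN _) h1 (translates_kernel_translate gAw f wAw).
  by rewrite -shiftE subrK.
apply: (translates_kernel_span gAw
  (P := fun c : chain k => exists f, translates_kernel A (c - shift k f))).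
  split; first by exists 0; rewrite linear0 subr0; exact: subspace0 (sN A).
  move=> a x y [f hf] [g hg]; exists (a *: f + g).
  rewrite linearP opprD addrACA -scalerBr.
  by have [_ h] := sN A; exact: h.
move=> v t [j Aj]; have [f hf] := translate_shift t j; exists f.
have := translates_kernel_translateU gA (translate (w *~ j) t) Aj.
rewrite translateD subrK -hf; congr translates_kernel; zmod.
Qed.

Lemma adjoin_homology (b : nat -> nat) :
  has_homology_mod (boundaryL R E) (translates_kernel A) b ->
  exists2 c : nat -> nat, (forall k, c k <= b k)%N &
    has_homology_mod (boundaryL R E) (translates_kernel (adjoin A w))
      (wang_betti c).
Proof.
move=> hb; apply: (wang_homology (u := shift)) hb =>
  [k x|k x|k|k x|k x|k x|k x].
- exact: boundary_boundary.
- by rewrite !shiftE linearB /=; congr (_ - _); rewrite -boundary_push.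
- exact: translates_kernel_subspace.
- exact: translates_kernel_boundary.
- exact: shift_orbit_kernel.
- exact: shift_inj.
- exact: translates_kernel_adjoin.
Qed.

End Adjoin.

Lemma translates_kernel0 k (c : chain k) :
  translates_kernel (fun x => x = 0) c <-> c = 0.
Proof.
split=> [h|->]; last exact: linear0.
apply/eqP/freeg_eqP => s; rewrite coeff0.
rewrite -(coeff_freeg_map_inj (f := translates (fun x => x = 0) (k:=k))).
  by rewrite h coeff0.
move=> t t' /translates_eq[|v -> ->]; last exact: translate0.
by split=> // x y -> ->; rewrite subr0.
Qed.

Fixpoint lattice_span (w : nat -> E) r : E -> Prop :=
  if r is r'.+1 then adjoin (lattice_span w r') (w r') else fun x => x = 0.

Lemma lattice_span_subgroup w r : subgroup (lattice_span w r).
Proof.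
elim: r => [|r IH]; last exact: adjoin_subgroup.
by split=> // x y -> ->; rewrite subr0.
Qed.

Lemma lattice_spanP w r x : lattice_span w r x <->
  exists z : nat -> int, x = \sum_(i < r) w i *~ z i.
Proof.
elim: r x => [|r IH] x /=.
  by split=> [->|[z ->]]; rewrite ?big_ord0 //; exists (fun=> 0);
    rewrite big_ord0.
split=> [[j /IH[z hz]]|[z ->]].
  exists (fun i => if i == r then j else z i).
  rewrite big_ord_recr /= eqxx; apply/eqP; rewrite -subr_eq hz; apply/eqP.
  by apply: eq_bigr => i _; rewrite ltn_eqF.
by exists (z r); apply/IH; exists z; rewrite big_ord_recr addrK.
Qed.

Lemma lattice_homology (w : nat -> E) r :
  has_homology_mod (boundaryL R E) (fun _ c => c = 0) (fun k => (k == 0)%N) ->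
  (0 < r)%N ->
  (forall z : nat -> int, \sum_(i < r) w i *~ z i = 0 ->
     forall i, (i < r)%N -> z i = 0) ->
  exists N b, [/\ has_homology_mod (boundaryL R E)
                    (translates_kernel (lattice_span w r)) b,
                  forall k, (N <= k)%N -> b k = 0%N
                & \sum_(k < N) (-1) ^+ k * (b k)%:Z = 0 :> int].
Proof.
move=> hE; case: r => // r _ wfree.
have {hE}hE : has_homology_mod (boundaryL R E)
    (translates_kernel (lattice_span w 0)) (fun k => (k == 0)%N).
  move: hE; congr (has_homology_mod (C := chainL R E) _ _ _).
  apply: functional_extensionality_dep => k.
  by apply: funext => c; apply: propext; rewrite translates_kernel0.
have indep i : (i < r.+1)%N -> forall j : int,
    lattice_span w i (w i *~ j) -> j = 0.
  move=> ir j /lattice_spanP[z hz].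
  pose z' l := if (l < i)%N then - z l else if l == i then j else 0.
  have := wfree z' _ i ir; rewrite /z' ltnn eqxx; apply.
  rewrite -(big_mkord xpredT (fun l =>
    w l *~ z' l)) (big_cat_nat _ (n := i)) //=;
    last exact: ltnW.
  rewrite (big_ltn ir) /z' ltnn eqxx hz big_nat [X in _ + (_ + X)]big_nat.
  rewrite (eq_bigr (fun l => - (w l *~ z l))) => [|l /andP[_ li]]; last first.
    by rewrite li mulrNz.
  rewrite -big_nat big_mkord [X in _ + (_ + X)]big1 => [|l /andP[il _]].
    by rewrite sumrN; zmod.
  by rewrite ltnNge (ltnW il) /= gtn_eqF // mulr0z.
(* All generators but the last only need to keep the Betti numbers eventually zero; the last one
   makes the alternating sum vanish, whence the positivity of the rank. *)
have [N [b [bh b0]]] : exists N b, has_homology_mod (boundaryL R E)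
    (translates_kernel (lattice_span w r)) b /\ forall k,
      (N <= k)%N -> b k = 0%N.
  have : (r <= r)%N by [].
  elim: {-2}r => [|i IH] ir.
    by exists 1%N, (fun k => (k == 0)%N); split=> // -[].
  have [N [b [bh b0]]] := IH (ltnW ir).
  have [c cb ch] := adjoin_homology (lattice_span_subgroup w i)
    (indep i (leqW ir)) bh.
  exists N.+1, (wang_betti c); split=> // -[//|k] Nk.
  have c0 j : (N <= j)%N -> c j = 0%N.
    by move=> /b0 bj; have := cb j; rewrite bj leqn0 => /eqP.
  by rewrite /wang_betti !c0 // ltnW.
have [c cb ch] := adjoin_homology (lattice_span_subgroup w r)
  (indep r (ltnSn r)) bh.
have c0 j : (N <= j)%N -> c j = 0%N.
  by move=> /b0 bj; have := cb j; rewrite bj leqn0 => /eqP.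
exists N.+1, (wang_betti c); split=> // [[//|k] Nk|].
  by rewrite /wang_betti !c0 // ltnW.
by apply: wang_betti_euler; exact: c0.
Qed.

End Translations.

(** * Lifting simplices along a quotient by a discrete group *)

Section SimplexSegments.
Variables (R : realType) (k : nat).
Local Notation Delta := (std_simplex R k).

Lemma simplex_lebesgue (Q : Delta -> Delta -> Prop) :
  (forall x : Delta, exists2 U, nbhs x U & forall y z, U y -> U z -> Q y z) ->
  exists2 e : R, 0 < e & forall y z : Delta,
    (forall i, `|set_val y 0 i - set_val z 0 i| < e) -> Q y z.
Proof.
move=> hQ.
have : \forall e \near (0 : R)^'+, forall y z : Delta,
    (forall i, `|set_val y 0 i - set_val z 0 i| < e) -> Q y z.
  apply: (@std_simplex_near_covering R k R (0 : R)^'+ _ (fun e y =>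
    forall z : Delta,
    (forall i, `|set_val y 0 i - set_val z 0 i| < e) -> Q y z)) => x.
  have [U [_ [[W oW <-] /= Wx] WU] UQ] := hQ x.
  have /nbhs_ballP[r r0 rW] : nbhs (set_val x) W by exact: open_nbhs_nbhs.
  have r20 : 0 < r / 2 by rewrite divr_gt0.
  exists (set_val @^-1` ball (set_val x) (r / 2)), [set e | e < r / 2]; split.
  - apply: (@set_val_continuous _ Delta x); exact: nbhsx_ballx.
  - exact: nbhs_right_lt.
  move=> y e [_ xy] er z yz.
  apply: UQ; apply: WU; apply: rW; split=> // i j; rewrite ord1.
    by have := xy 0 j; rewrite /ball /= => h;
      rewrite (lt_trans h) // ltr_pdivrMr // ltr_pMr // ltr1n.
  have := xy 0 j; rewrite /ball /= => h; rewrite [r]splitr.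
  rewrite -(subrK (set_val y 0 j) (set_val x 0 j)) -addrA.
  by rewrite (le_lt_trans (ler_normD _ _)) // ltrD // (lt_trans (yz j)).
move=> h; near (0 : R)^'+ => e; exists e => //.
by near: e.
Unshelve. all: by end_near. Qed.

(** The division points of the segment from vertex 0 to [x] into [N + 1] equal parts; [minn] keeps
    them in the simplex for every [j]. *)
Definition segment_row N j (x : 'rV[R]_k.+1) : 'rV[R]_k.+1 :=
  let t := (minn j N.+1)%:R / N.+1%:R in
  (1 - t) *: delta_mx 0 0 + t *: x.

Let param_ge0 N j : 0 <= (minn j N.+1)%:R / N.+1%:R :> R.
Proof. by rewrite divr_ge0. Qed.

Let param_le1 N j : 0 <= 1 - (minn j N.+1)%:R / N.+1%:R :> R.
Proof. by rewrite subr_ge0 ler_pdivrMr // mul1r ler_nat geq_minr. Qed.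

Lemma segment_row_simplex N j (x : Delta) :
  segment_row N j (set_val x) \in Delta.
Proof.
apply/mem_set; split=> [i|].
  by rewrite !mxE addr_ge0 // mulr_ge0 ?std_simplex_ge0 ?param_le1 ?param_ge0
    ?ler0n.
under eq_bigr do rewrite !mxE; rewrite big_split -!mulr_sumr /=.
rewrite std_simplex_sum (bigD1 0) //= big1 => [|i i0];
  last by rewrite (negPf i0).
by rewrite addr0 !mulr1 subrK.
Qed.

Definition segment N j (x : Delta) : Delta :=
  exist _ (segment_row N j (set_val x)) (segment_row_simplex N j x).

Lemma set_val_segment N j x :
  set_val (segment N j x) = segment_row N j (set_val x).
Proof. exact: set_val_exist. Qed.

Lemma segment_continuous N j : continuous (segment N j).
Proof.
move=> x; apply: continuous_to_set_type; apply: (cvg_mx (F := nbhs x)) => i l.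
rewrite ord1 /=; set t := (minn j N.+1)%:R / N.+1%:R : R.
have E (y : Delta) : set_val (segment N j y) 0 l =
    (1 - t) * (delta_mx 0 0 : 'rV[R]_k.+1) 0 l + t * set_val y 0 l.
  by rewrite set_val_segment !mxE.
rewrite E; under eq_fun do rewrite E.
apply: (cvgD (F := nbhs x)); first exact: cvg_cst.
apply: (cvgM (F := nbhs x)); first exact: cvg_cst.
exact: std_simplex_coord_continuous.
Qed.

Definition base_vertex : Delta := segment 0 0 (std_simplex_inhabited R k).

Lemma segment_first N x : segment N 0 x = base_vertex.
Proof.
apply: set_type_eq; rewrite !set_val_segment /segment_row !min0n !mul0r.
by rewrite !scale0r.
Qed.

Lemma segment_last N x : segment N N.+1 x = x.
Proof.
apply: set_type_eq; rewrite set_val_segment /segment_row minnn divff //.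
by rewrite subrr scale0r add0r scale1r.
Qed.

(** Consecutive division points are at coordinate distance at most [1 / (N + 1)] for all [x] at
    once, so a Lebesgue number yields a single [N]. *)
Lemma simplex_chain (Q : Delta -> Delta -> Prop) :
  (forall x : Delta, exists2 U, nbhs x U & forall y z, U y -> U z -> Q y z) ->
  exists N, forall x j, (j < N.+1)%N -> Q (segment N j x) (segment N j.+1 x).
Proof.
move=> /simplex_lebesgue[e e0 eQ].
have [N Ne] : exists N, N.+1%:R^-1 < e.
  exists (Num.trunc e^-1); rewrite invf_plt ?posrE //.
  exact: truncnS_gt.
exists N => x j jN; apply: eQ => i; rewrite !set_val_segment !mxE.
rewrite (minn_idPl jN) (minn_idPl (ltnW jN)).
set a := (0 == _) && _; have a01 : 0 <= (a%:R : R) <= 1 by case: a;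
  rewrite ?ler01 ?lexx.
have x01 : 0 <= set_val x 0 i <= 1 by rewrite std_simplex_ge0 std_simplex_le1.
rewrite [X in `|X|](_ : _ = (a%:R - set_val x 0 i) / N.+1%:R); last first.
  rewrite -[j.+1%:R]natr1 mulrDl; ring.
apply: le_lt_trans Ne; rewrite normrM [X in _ * X]ger0_norm // ler_piMl //.
by rewrite ler_norml; lra.
Qed.

End SimplexSegments.

Section Covering.
Variables (R : realType) (K : numFieldType) (E : normedModType K).
Variables (A : E -> Prop) (gA : subgroup A) (eps : K) (eps0 : 0 < eps).
Hypothesis A_discrete : forall a, A a -> `|a| < eps -> a = 0.

(** A simplex with values in a discrete subgroup is locally constant, and the subdivided segments
    carry its value from the base vertex to every point. *)
Lemma discrete_constant k (g : singular_simplex R E k) :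
  (forall x, A (g x)) -> forall x y, g x = g y.
Proof.
move=> gAx; have [_ AB] := gA.
have [x|N hN] := @simplex_chain R k (fun x y => g x = g y).
  exists (g @^-1` ball (g x) (eps / 2)).
    by apply: (@cts_fun _ _ g x); apply: nbhsx_ballx; rewrite divr_gt0.
  move=> y z; rewrite -!ball_normE /= => xy xz; apply/eqP; rewrite -subr_eq0.
  apply/eqP; apply: A_discrete; first exact: AB.
  rewrite -(subrKA (g x)) [eps]splitr (le_lt_trans (ler_normD _ _)) //.
  by rewrite ltrD // distrC.
have h x j : (j <= N.+1)%N -> g (segment N j x) = g (base_vertex R k).
  elim: j => [|j IH] jN; first by rewrite segment_first.
  by rewrite -hN // IH // ltnW.
have h1 x : g x = g (base_vertex R k).
  by rewrite -(h x N.+1) // segment_last.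
by move=> x y; rewrite h1 [RHS]h1.
Qed.

Variables (X : topologicalType) (proj : E -> X).
Hypothesis proj_surj : forall t, exists x, proj x = t.
Hypothesis proj_eq : forall x y, proj x = proj y <-> A (x - y).
Hypothesis proj_open : forall x U, nbhs x U -> nbhs (proj x) (proj @` U).

Section Lift.
Variables (k : nat) (f : singular_simplex R X k).
Local Notation Delta := (std_simplex R k).

(** [h] is a short displacement from a lift of [f x] to a lift of [f y]. The bound [eps / 4] keeps a
    sum of four such terms below the discreteness bound [eps]. *)
Let step (x y : Delta) (h : E) :=
  `|h| < eps / 4 /\ exists2 e, proj e = f x & proj (e + h) = f y.

Let stepP x y h e : step x y h -> proj e = f x -> proj (e + h) = f y.
Proof.
move=> [_ [e' e'x <-]] ex; apply/proj_eq.
by rewrite opprD addrACA subrr addr0; apply/proj_eq; rewrite ex.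
Qed.

(** The displacement varies continuously: for lifts [u], [v] near [e], [e + h], the element
    [u + h' - v] of [A] is shorter than [eps], hence 0. *)
Let step_near (x y : Delta) h (d : K) : step x y h -> 0 < d ->
  exists U V, [/\ nbhs x U, nbhs y V & forall x' y' h', U x' -> V y' ->
    step x' y' h' -> `|h - h'| < d].
Proof.
move=> [hr [e ex ey]] d0; have [_ AB] := gA.
have d20 : 0 < d / 2 by rewrite divr_gt0.
have r0 : 0 < eps / 4 by rewrite divr_gt0.
pose B (v : E) : set E := ball v (d / 2) `&` ball v (eps / 4).
have nB v : nbhs v (B v) by apply: filterI; exact: nbhsx_ballx.
exists (f @^-1` (proj @` B e)), (f @^-1` (proj @` B (e + h))); split.
- by apply: (@cts_fun _ _ f x); rewrite -ex; exact: proj_open.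
- by apply: (@cts_fun _ _ f y); rewrite -ey; exact: proj_open.
move=> x' y' h' [u [ud ur] ux] [v [vd vr] vy] st.
rewrite -!ball_normE /= in ud ur vd vr.
have := stepP st ux; rewrite -vy => /proj_eq Auv.
have [h'r _] := st.
have norm4 (a b c' d' : E) : `|a| < eps / 4 -> `|b| < eps / 4 ->
    `|c'| < eps / 4 -> `|d'| < eps / 4 -> `|a - b + (c' - d')| < eps.
  move=> ha hb hc hd.
  rewrite (splitr eps) (le_lt_trans (ler_normD _ _)) // ltrD //.
    rewrite (le_lt_trans (ler_normB _ _)) //.
    by have := ltrD ha hb; congr (_ < _); field.
  rewrite (le_lt_trans (ler_normB _ _)) //.
  by have := ltrD hc hd; congr (_ < _); field.
have uh : u + h' - v = 0.
  apply: A_discrete => //.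
  have -> : u + h' - v = h' - h + ((e + h - v) - (e - u)) by zmod.
  exact: norm4.
have -> : h - h' = (e + h - v) - (e - u) + - (u + h' - v) by zmod.
rewrite uh oppr0 addr0 (splitr d) (le_lt_trans (ler_normB _ _)) //.
exact: ltrD.
Qed.

(** The lift is explicit: a lift of the base vertex plus the displacements along the subdivided
    segment to [x]. Prescribing the path to [x] removes any ambiguity of path. *)
Lemma simplex_lift : exists F :
  singular_simplex R E k, forall x, proj (F x) = f x.
Proof.
have [x|N hN] := @simplex_chain R k (fun x y => exists h, step x y h).
  have [e ex] := proj_surj (f x).
  (* Two points of a ball of radius [eps / 8] differ by less than [eps / 4], as [step] demands. *)
  have e80 : 0 < eps / 8 by rewrite divr_gt0.
  exists (f @^-1` (proj @` ball e (eps / 8))).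
    by apply: (@cts_fun _ _ f x); rewrite -ex; apply: proj_open;
      exact: nbhsx_ballx.
  move=> y z [u eu uy] [v ev vz]; exists (v - u); split; last first.
    by exists u; rewrite ?subrKC.
  rewrite -!ball_normE /= in eu ev.
  have -> : v - u = (e - u) - (e - v) by zmod.
  rewrite (le_lt_trans (ler_normB _ _)) //.
  by have := ltrD eu ev; congr (_ < _); field.
(* The choice is arbitrary for each pair of points; [step_near] makes any such choice continuous. *)
pose h x y := xget 0 [set h | step x y h].
have hP x j : (j < N.+1)%N ->
    step (segment N j x) (segment N j.+1 x) (h (segment N j x) (segment N j.+1
      x)).
  by move=> jN; have [v hv] := hN x j jN; exact: (xgetPex 0 (ex_intro _ v hv)).
have [e0 he0] := proj_surj (f (base_vertex R k)).
pose F m x := e0 + \sum_(j < m) h (segment N j x) (segment N j.+1 x).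
have Flift m x : (m <= N.+1)%N -> proj (F m x) = f (segment N m x).
  elim: m => [|m IH] mN; first by rewrite /F big_ord0 addr0 segment_first.
  rewrite /F big_ord_recr addrA; apply: stepP; first exact: hP.
  exact: IH (ltnW mN).
have Fcont m : (m <= N.+1)%N -> continuous (F m).
  elim: m => [|j IH] jN x.
    have F0 y : F 0 y = e0 by rewrite /F big_ord0 addr0.
    rewrite (funext F0); exact: cst_continuous.
  have FS y : F j.+1 y = F j y + h (segment N j y) (segment N j.+1 y).
    by rewrite /F big_ord_recr addrA.
  rewrite (funext FS).
  apply: (cvgD (F := nbhs x)); first exact: IH (ltnW jN) x.
  apply/cvgrPdist_lt => d d0.
  have [U [V [Ux Vx UV]]] := step_near (hP x j jN) d0.
  have Ux' : nbhs x (segment N j @^-1` U) := @segment_continuous R k N j x _ Ux.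
  have Vx' : nbhs x (segment N j.+1 @^-1` V) :=
    @segment_continuous R k N j.+1 x _ Vx.
  have UVx : nbhs x (segment N j @^-1` U `&` segment N j.+1 @^-1` V).
    exact: filterI.
  apply: (filterS (F := nbhs x) _ UVx).
  by move=> y [Uy Vy] /=; apply: UV Uy Vy _; exact: hP.
exists (mkcts (Fcont N.+1 (leqnn _))) => x.
by rewrite /mkcts Flift // segment_last.
Qed.

End Lift.
End Covering.

Section CoveringHomology.
Variables (R : realType) (K : numFieldType) (E : normedModType K).
Variables (A : E -> Prop) (gA : subgroup A) (X : topologicalType).
Variable p : continuousType E X.
Hypothesis p_lift : forall k (f : singular_simplex R X k),
  exists s, push p s = f.
Hypothesis p_eq : forall k (s t : singular_simplex R E k),
  push p s = push p t <-> exists2 v, A v & s = translate v t.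

Let P k : chainL R E k -> chainL R X k := freeg_map (push p (k:=k)).

HB.instance Definition _ k := GRing.Linear.on (@P k).

Let P_kernel k (c : chainL R E k) : P c = 0 <-> translates_kernel A c.
Proof.
split.
  apply: freeg_map_kernel; first exact: translates_kernel_subspace.
  by move=> s t /p_eq[v Av ->]; exact: translates_kernel_translateU.
apply: (translates_kernel_span gA (P := fun c : chainL R E k => P c = 0)).
  split=> [|a x y hx hy]; first exact: linear0.
  by rewrite linearP /= hx hy scaler0 addr0.
move=> v t Av; rewrite linearB /= /P !freeg_mapU.
by rewrite (_ : push p (translate v t) = push p t) ?subrr //; apply/p_eq;
  exists v.
Qed.

Let P_surj k (c : chainL R X k) : exists c0 : chainL R E k, P c0 = c.
Proof. by apply: freeg_map_surj => s; exact: p_lift. Qed.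

Let P_boundary k (c : chainL R E k.+1) :
  boundary (P c : singular_chain R X k.+1) = P (boundaryL R E k c).
Proof. exact: boundary_push. Qed.

(** Pushing chains forward is a surjective chain map with kernel [translates_kernel A], so homology
    modulo that kernel is the homology of [X]. *)
Lemma covering_betti b :
  has_homology_mod (boundaryL R E) (translates_kernel A) b ->
  forall k, has_betti R X k (b k).
Proof.
move=> hb k; have [z [zZ zgen zfree]] := hb k.
have Pcycle (c : chainL R E k) :
    is_cycle (P c : singular_chain R X k) <-> cycle_mod (boundaryL R E)
      (translates_kernel A) c.
  case: k c {z zZ zgen zfree} => [//|k] c.
  by rewrite /= P_boundary; exact: P_kernel.
have sumE (a : 'I_(b k) -> rat) :
    \sum_i a i *: (P (z i) : singular_chain R X k) = P (lincomb (\row_i a i) z).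
  by rewrite linear_lincomb /lincomb; apply: eq_bigr => i _; rewrite mxE.
exists (fun i => P (z i)); split.
- by move=> i; apply/Pcycle; exact: zZ.
- move=> c; have [c0 <-] := P_surj c => /Pcycle/zgen[a [e he]].
  exists (fun i => a 0 i); rewrite sumE.
  have -> : \row_i a 0 i = a by apply/rowP => i; rewrite mxE.
  exists (P e); rewrite P_boundary.
  move/P_kernel: he; rewrite !linearB /= => /eqP.
  by rewrite subr_eq0 => /eqP ->.
- move=> a; rewrite sumE => -[d]; have [d0 <-] := P_surj d.
  rewrite P_boundary => /eqP;
    rewrite eq_sym -subr_eq0 -linearB => /eqP/P_kernel h.
  have /rowP a0 : \row_i a i = 0 by apply: zfree; exists d0.
  by move=> i; have := a0 i; rewrite !mxE.
Qed.

End CoveringHomology.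

(** * Finite spaces with only constant simplices *)

Section DiscreteSpace.
Variables (R : realType) (X : topologicalType) (d : nat) (t : 'I_d -> X).
Hypothesis t_inj : injective t.
Hypothesis t_surj : forall x, exists i, t i = x.
Hypothesis X_const : forall k (s : singular_simplex R X k) x y, s x = s y.

Let const_simplex k (x : X) : singular_simplex R X k := cst x.

Let const_simplexP k (s : singular_simplex R X k) :
  s = const_simplex k (s (std_simplex_inhabited R k)).
Proof. by apply/continuousEP => x; rewrite /const_simplex /=;
  exact: X_const. Qed.

Let resize k l (s : singular_simplex R X k) : singular_simplex R X l :=
  const_simplex l (s (std_simplex_inhabited R k)).

Let resizeK k l : cancel (@resize k l) (@resize l k).
Proof. by move=> s; rewrite [RHS]const_simplexP. Qed.

(** All [k + 2] faces of a constant simplex coincide, and their signs add up to 1 for odd [k] and to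
    0 for even [k]. *)
Let boundary_resize k (c : singular_chain R X k.+1) :
  boundary c = (odd k)%:R *: freeg_map (@resize k.+1 k) c.
Proof.
move: c; apply: (freeg_linear_ext (f := boundaryL R X k)
  (g := (odd k)%:R \*: freeg_map (@resize k.+1 k))) => s /=.
rewrite [LHS]boundaryU freeg_mapU /simplex_boundary.
have altsum : \sum_(i < k.+2) (-1) ^+ i = (odd k)%:R :> rat.
  elim: k {s} => [|k IH]; first by rewrite big_ord_recr big_ord1.
  rewrite big_ord_recr /= IH -signr_odd /=.
  by case: (odd k).
rewrite -altsum scaler_suml; apply: eq_bigr => i _; congr (_ *: << _ >>).
by apply/continuousEP => x; rewrite /resize /=; exact: X_const.
Qed.

Let zero_betti k : has_betti R X k.+1 0.
Proof.
exists (fun i => 0); split=> [[]//|c /= c0|a _ []//].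
exists (fun=> 0); rewrite big_ord0 subr0.
move: c0; rewrite boundary_resize.
(* For even [k] every chain is a boundary from the next degree; for odd [k] the boundary map is
   injective, so the only cycle is 0. *)
case ok : (odd k); last first.
  move=> _; exists (freeg_map (@resize k.+1 k.+2) c).
  rewrite boundary_resize /= ok scale1r freeg_map_comp.
  move: c; apply: (freeg_linear_ext (f := freeg_map _) (g := idfun)) => s /=.
  by rewrite freeg_mapU /= resizeK.
rewrite scale1r => c0; exists 0; rewrite (linear0 (boundaryL R X k.+1)).
apply/esym/eqP/freeg_eqP => s; rewrite coeff0.
rewrite -(coeff_freeg_map_inj (can_inj (@resizeK k.+1 k))).
by rewrite c0 coeff0.
Qed.

Lemma discrete_euler_char : has_euler_char R X d%:Z.
Proof.
exists 1%N, (fun k => if k is 0 then d else 0%N); split=> [[|k]|[]//|].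
- pose z i : singular_chain R X 0 := << const_simplex 0 (t i) >>.
  exists z; split=> [//|c _|a [e]].
    apply: (freeg_span (P := fun c : chainL R X 0 => exists a : 'I_d -> rat,
      is_boundary (c - \sum_i a i *: z i : singular_chain R X 0))).
      split.
        exists (fun=> 0), 0; rewrite (linear0 (boundaryL R X 0)).
        by rewrite big1 ?subr0 // => i _; rewrite scale0r.
      move=> k x y [a [e he]] [b [f hf]].
      exists (fun i => k * a i + b i), (k *: e + f).
      rewrite (linearP (boundaryL R X 0)) /= he hf.
      under [in RHS]eq_bigr do rewrite scalerDl -scalerA.
      rewrite big_split /= -scaler_sumr scalerBr; zmod.
    move=> s; have [i ti] := t_surj (s (std_simplex_inhabited R 0)).
    exists (fun j => (i == j)%:R), 0; rewrite (linear0 (boundaryL R X 0)).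
    rewrite (bigD1 i) //= eqxx scale1r big1 ?addr0 => [|j ji].
      by rewrite /z ti -const_simplexP subrr.
    by rewrite eq_sym (negPf ji) scale0r.
  rewrite boundary_resize scale0r => h i.
  have := congr1 (coeff (const_simplex 0 (t i))) h.
  rewrite coeff0 raddf_sum (bigD1 i) //= big1 ?addr0.
    by rewrite coeffZ coeffU mul1r eqxx mulr1.
  move=> j ji; rewrite coeffZ coeffU mul1r; case: eqP => [|_];
    last by rewrite mulr0.
  move=> /continuousEP/(_ (std_simplex_inhabited R 0)) /t_inj e'.
  by rewrite e' eqxx in ji.
- exact: zero_betti.
- by rewrite big_ord1 expr0 mul1r.
Qed.

End DiscreteSpace.

(** * Fixed points on the torus *)

Lemma mulmx_continuous (K : numFieldType) m n (M : 'M[K]_(m, n)) :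
  continuous (fun x : 'cV[K]_n => M *m x).
Proof.
move=> x; apply: (cvg_mx (F := nbhs x)) => i j.
have sumE y : (M *m y) i j = \sum_l M i l * y l j by rewrite mxE.
suff : continuous (fun y : 'cV[K]_n => \sum_l M i l * y l j).
  by move=> /(_ x); rewrite /continuous_at -sumE -(funext sumE).
apply: continuous_big => [|l _ y]; first exact: add_continuous.
apply: (cvgM (F := nbhs y)); first exact: cvg_cst.
exact: coord_continuous.
Qed.

Lemma mulmx_small (K : numFieldType) m n (M : 'M[K]_(m, n)) :
  exists2 e : K, 0 < e &
    forall a : 'cV[K]_n, `|a| < e -> forall i, `|(M *m a) i 0| < 1.
Proof.
have h1 : nbhs (M *m (0 : 'cV[K]_n)) (ball (0 : 'cV[K]_m) 1).
  by rewrite mulmx0; exact: nbhsx_ballx.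
have /nbhs_ballP[e /= e0 eB] := @mulmx_continuous _ _ _ M (0 : 'cV[K]_n) _ h1.
exists e => // a ae i.
have : ball (0 : 'cV[K]_n) e a by rewrite -ball_normE /= sub0r normrN.
by move=> /eB [_ /(_ i 0)]; rewrite -ball_normE /= mxE sub0r normrN.
Qed.

Lemma real_complex_continuous (R : realType) :
  continuous (real_complex R : R -> R[i]).
Proof.
move=> x; apply/(@cvgrPdist_lt _ R[i]^o) => e e0.
have er : e = real_complex R (complex.Re e) by rewrite RRe_real // gtr0_real.
have e0' : 0 < complex.Re e by rewrite er ltcR in e0.
have : nbhs (x : R) (ball (x : R) (complex.Re e)) by exact: nbhsx_ballx.
apply: filterS => y /= xy; rewrite er -rmorphB normc_def /= expr0n addr0.
by rewrite sqrtr_sqr ltcR.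
Qed.

Section TorusTopology.
Variables (R : realType) (n : nat) (L : lattice n).
Local Notation E := ('cV[R[i]]_n : normedModType R[i]).
Local Notation T := (torus R L).

Definition in_lattice (x : E) : Prop := exists2 v, L v & x = map_mx ratr v.

Lemma in_lattice_subgroup : subgroup in_lattice.
Proof.
have [Z0 ZB] := latticeC_zmod_closed R L; split; first exact/asboolP.
by move=> x y hx hy; apply/asboolP; apply: ZB; exact/asboolP.
Qed.

Lemma torus_pi_continuous : continuous (@torus_pi R n L).
Proof. exact: pi_continuous. Qed.

Lemma torus_pi_surj (t : T) : exists x, torus_pi L x = t.
Proof. by exists (generic_quotient.repr t); exact: reprK. Qed.

Lemma torus_pi_eq (x y : E) :
  torus_pi L x = torus_pi L y <-> in_lattice (x - y).
Proof. exact: torus_piP. Qed.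

(** The saturation of an open set is the union of its translates by the lattice. *)
Lemma torus_pi_open (x : E) (U : set E) :
  nbhs x U -> nbhs (torus_pi L x) (torus_pi L @` U).
Proof.
rewrite nbhsE => -[V [oV Vx] VU].
suff h : nbhs (torus_pi L x) (torus_pi L @` V).
  by apply: filterS h => t [v Vv <-]; exists v => //; exact: VU.
apply: open_nbhs_nbhs; split; last by exists x.
rewrite /open /= /quotient_open.
have -> : \pi_(quotient_topology _)%qT @^-1` (torus_pi L @` V) =
    \bigcup_(a in [set a | in_lattice a]) (fun y : E => a + y) @^-1` V.
  apply/seteqP; split=> y /=.
    move=> [v Vv /torus_pi_eq h]; exists (v - y) => //=.
    by rewrite subrK.
  move=> [a La Vay]; exists (a + y) => //; apply/torus_pi_eq.
  by rewrite addrK.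
apply: bigcup_open => a La.
by apply: open_comp => // y _; exact: (@translation_continuous _ E).
Qed.

Variables (B : 'M[rat]_n) (B_unit : B \in unitmx).
Hypothesis LE : (L : set _) = [set B *m map_mx intr z | z in [set: 'cV[int]_n]].

Local Notation toC := (map_mx (ratr : rat -> R[i])).

Lemma map_ratr_intr (z : 'cV[int]_n) : toC (map_mx intr z) = map_mx intr z.
Proof. by apply/matrixP => i j; rewrite !mxE ratr_int. Qed.

Lemma lattice_mem v : L v <-> exists z : 'cV[int]_n, v = B *m map_mx intr z.
Proof.
by rewrite LE; split=> [[z _ <-]|[z ->]]; exists z.
Qed.

(** The coordinates of a lattice vector in the basis [B] are integers, and those of a short vector
    have modulus less than 1. *)
Lemma in_lattice_discrete :
  exists2 e : R[i], 0 < e & forall a, in_lattice a -> `|a| < e -> a = 0.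
Proof.
have [e e0 eB] := mulmx_small (toC (invmx B)).
exists e => // a [v /lattice_mem[z ->] aE] ae; rewrite aE.
suff -> : z = 0 by rewrite !map_mx0 mulmx0 map_mx0.
apply/colP => i; have := eB a ae i.
rewrite aE -map_mxM mulKmx // map_ratr_intr !mxE.
by rewrite -intr_norm -[1]/(1%:~R) ltr_int; lia.
Qed.

Definition lattice_gen (j : nat) : E :=
  if insub j is Some i then toC (col i B) else 0.

Lemma sum_lattice_gen (z : nat -> int) :
  \sum_(i < n) lattice_gen i *~ z i =
  toC (B *m map_mx intr (\col_(i < n) z i)).
Proof.
apply/matrixP => i j; rewrite summxE !mxE rmorph_sum.
apply: eq_bigr => l _; rewrite /lattice_gen valK.
by rewrite -scaler_int !mxE rmorphM /= ratr_int mulrC.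
Qed.

Lemma lattice_span_gen : lattice_span lattice_gen n = in_lattice.
Proof.
apply/funext => x; apply/propext; rewrite lattice_spanP; split.
  move=> [z ->]; exists (B *m map_mx intr (\col_(i < n) z i)).
    by apply/lattice_mem; exists (\col_(i < n) z i).
  exact: sum_lattice_gen.
move=> [v /lattice_mem[z ->] ->].
pose z' (i : nat) : int := if insub i is Some i' then z i' 0 else 0.
exists z'; have := sum_lattice_gen z'.
have -> : \col_(i < n) z' i = z by apply/colP => i; rewrite mxE /z' valK.
exact: esym.
Qed.

Lemma lattice_gen_free (z : nat -> int) :
  \sum_(i < n) lattice_gen i *~ z i = 0 ->
  forall i, (i < n)%N -> z i = 0.
Proof.
move=> /(etrans (esym (sum_lattice_gen z))).
rewrite -(map_mx0 (ratr : rat -> R[i])) => /map_mx_inj h i lt_in.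
have : map_mx intr (\col_(i < n) z i) = 0 :> 'cV[rat]_n.
  by apply: (can_inj (mulKmx B_unit)); rewrite h mulmx0.
move=> /colP/(_ (Ordinal lt_in)); rewrite !mxE /=.
by move/eqP; rewrite intr_eq0 => /eqP.
Qed.

Lemma torus_cover_homology : (0 < n)%N ->
  exists N b, [/\ has_homology_mod (boundaryL R E) (translates_kernel
    in_lattice) b,
                  forall k, (N <= k)%N -> b k = 0%N
                & \sum_(k < N) (-1) ^+ k * (b k)%:Z = 0 :> int].
Proof.
move=> n0; rewrite -lattice_span_gen.
apply: lattice_homology => //; last exact: lattice_gen_free.
apply: (@cone_homology R E (fun t x => real_complex R t *: x) 0).
- move=> [t x] /=; apply: (cvgZ (F := nbhs (t, x))).
    apply: (continuous_comp (x := (t, x)) (f := fst)); first exact: cvg_fst.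
    exact: real_complex_continuous.
  exact: cvg_snd.
- by move=> x; rewrite scale0r.
- by move=> x; rewrite scale1r.
Qed.

Lemma torus_lift k (f : singular_simplex R T k) :
  exists F : singular_simplex R E k, forall x, torus_pi L (F x) = f x.
Proof.
have [e e0 he] := in_lattice_discrete.
exact: (@simplex_lift _ _ _ _ in_lattice_subgroup e e0 he _ _ torus_pi_surj
  torus_pi_eq torus_pi_open).
Qed.

Lemma in_lattice_constant k (g : singular_simplex R E k) :
  (forall x, in_lattice (g x)) -> forall x y, g x = g y.
Proof.
have [e e0 he] := in_lattice_discrete.
exact: (@discrete_constant _ _ _ _ in_lattice_subgroup e e0 he).
Qed.

End TorusTopology.

Section TorusEuler.
Variables (R : realType) (n : nat) (L : lattice n).
Local Notation E := ('cV[R[i]]_n : normedModType R[i]).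
Local Notation T := (torus R L).
Local Notation toC := (map_mx (ratr : rat -> R[i])).

Lemma torus_map1 (t : T) : torus_map 1%:M t = t.
Proof.
have [x <-] := torus_pi_surj t; rewrite torus_map_pi => [|v].
  by rewrite map_mx1 mul1mx.
by rewrite mul1mx.
Qed.

Lemma torus_lift_set_type (F : set T) k (f : singular_simplex R F k) :
  exists s : singular_simplex R E k, forall x, torus_pi L (s x) = set_val (f x).
Proof.
have [B uB LE] := lattice_basis L.
have fc : continuous (set_val \o f).
  by move=> x; apply: continuous_comp;
    [exact: cts_fun|exact: set_val_continuous].
exact: (torus_lift uB LE (mkcts fc)).
Qed.

Lemma torus_euler : (0 < n)%N ->
  has_euler_char R (set_type (fixed_points (@torus_map R n L 1%:M))) 0.
Proof.
move=> n0; have [B uB LE] := lattice_basis L.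
have [N [b [bh b0 bE]]] := torus_cover_homology R uB LE n0.
pose F := fixed_points (@torus_map R n L 1%:M).
have FT (t : T) : t \in F by apply/mem_set; exact: torus_map1.
pose p (x : E) : F := exist _ (torus_pi L x) (FT _).
have pE x : set_val (p x) = torus_pi L x by exact: set_val_exist.
have pc : continuous p.
  move=> x; apply: continuous_to_set_type.
  rewrite (_ : set_val \o p = torus_pi L); first exact: torus_pi_continuous.
  by apply/funext => y /=; rewrite pE.
exists N, b; split=> // k.
apply: (covering_betti (in_lattice_subgroup R L) (p := mkcts pc)) bh k => {}k.
  move=> f; have [s sf] := torus_lift_set_type f; exists s.
  by apply/continuousEP => x; apply: set_type_eq; rewrite /push /= /mkcts pE.
move=> s t; split=> [st|[v Lv ->]]; last first.
  apply/continuousEP => x; apply: set_type_eq; rewrite /push /= /mkcts !pE.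
  apply/torus_pi_eq; rewrite [X in in_lattice _ X](_ : _ = v) //.
  exact: (addrK (t x) v).
(* Two lifts of one simplex differ by a continuous function into the lattice, hence by a single
   lattice vector. *)
have gc : continuous (fun x => s x - t x).
  by move=> x; apply: (cvgB (F := nbhs x)); exact: cts_fun.
have gL x : in_lattice L (mkcts gc x).
  apply/torus_pi_eq; rewrite -!pE.
  by have /continuousEP/(_ x) /= := st; rewrite /push /= /mkcts => ->.
pose x0 := std_simplex_inhabited R k.
exists (mkcts gc x0); first exact: gL.
apply/continuousEP => x; rewrite translateE.
by rewrite (in_lattice_constant uB LE (g := mkcts gc) gL x0 x) /mkcts subrK.
Qed.

(** The fixed points form [(M - 1)^-1 L / L], which [M - 1] identifies with [L / (M - 1) L]; in the
    basis [B] its order is the index of the image of the integer matrix [C]. *)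
Lemma torus_fixed_euler (M : 'M[rat]_n) (d : nat) :
  (forall v, L v -> L (M *m v)) ->
  `|\det (M - 1%:M)| = d%:R -> \det (M - 1%:M) != 0 ->
  has_euler_char R (set_type (fixed_points (@torus_map R n L M))) d%:Z.
Proof.
move=> LM detd det0; have [B uB LE] := lattice_basis L.
set M1 := M - 1%:M in detd det0.
have uM : M1 \in unitmx by rewrite unitmxE unitfE.
have LM1 v : L v -> exists z : 'cV[int]_n, M1 *m v = B *m map_mx intr z.
  move=> Lv; rewrite mulmxBl mul1mx.
  have /(lattice_mem LE)[z1 ->] := LM v Lv; have /(lattice_mem LE)[z2 ->] := Lv.
  by exists (z1 - z2); rewrite map_mxB mulmxBr.
have [C CE] : exists C : 'M[int]_n, M1 *m B = B *m map_mx intr C.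
  have /fin_all_exists[c cE] : forall j, exists z : 'cV[int]_n,
      M1 *m col j B = B *m map_mx intr z.
    move=> j; apply: LM1; apply/(lattice_mem LE); exists (delta_mx j 0).
    rewrite colE; congr (_ *m _); apply/matrixP => i l.
    by rewrite !mxE; case: (_ && _).
  exists (\matrix_(i, j) c j i 0); apply/matrixP => i j.
  have := congr1 (fun v : 'cV[rat]_n => v i 0) (cE j).
  rewrite colE mulmxA -colE [LHS]mxE => ->; rewrite !mxE.
  by apply: eq_bigr => l _; rewrite !mxE.
have detC : \det M1 = (\det C)%:~R.
  have := congr1 determinant CE; rewrite !det_mulmx det_map_mx mulrC.
  by apply: mulfI; rewrite -unitfE -unitmxE.
have dE : d = `|\det C|%N.
  apply/eqP; rewrite -(eqr_nat rat) -detd detC -intr_norm.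
  by rewrite -abszE -pmulrn.
have detC0 : \det C != 0 by apply: contraNneq det0 => C0; rewrite detC C0.
have [r [rgen rinj]] := lattice_index detC0; rewrite dE.
pose y i : 'cV[rat]_n := invmx M1 *m (B *m map_mx intr (r i)).
have yE i : M1 *m y i = B *m map_mx intr (r i) by rewrite mulKVmx.
have LMr x : in_lattice L (toC M *m x - x) <-> torus_map M (torus_pi L x) =
  torus_pi L x.
  by rewrite torus_map_pi //; split=> [/torus_pi_eq|/torus_pi_eq].
have toM1 (x : E) : toC M *m x - x = toC M1 *m x.
  by rewrite map_mxB map_mx1 mulmxBl mul1mx.
have intr_mx_inj (u v : 'cV[int]_n) :
    map_mx intr u = map_mx intr v :> 'cV[rat]_n -> u = v.
  move=> /matrixP uv; apply/matrixP => i j.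
  by have := uv i j; rewrite !mxE => /intr_inj.
pose F := fixed_points (@torus_map R n L M).
have yF i : torus_pi L (toC (y i)) \in F.
  apply/mem_set/LMr; rewrite toM1 -map_mxM yE.
  by exists (B *m map_mx intr (r i)) => //; apply/(lattice_mem LE);
    exists (r i).
pose t i : set_type F := exist _ (torus_pi L (toC (y i))) (yF i).
have tE i : set_val (t i) = torus_pi L (toC (y i)) by exact: set_val_exist.
apply: (@discrete_euler_char R (set_type F) `|\det C|%N t).
- move=> i j /(congr1 set_val); rewrite !tE => /torus_pi_eq.
  move=> [v /(lattice_mem LE)[z ->]]; rewrite -map_mxB => /map_mx_inj h.
  apply: (rinj i j z); apply: intr_mx_inj.
  apply: (can_inj (mulKmx uB)); rewrite map_mxB map_mxM mulmxBr -!yE -mulmxBr h.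
  by rewrite !mulmxA CE.
- move=> x; have [e ex] := torus_pi_surj (set_val x).
  have : torus_map M (set_val x) = set_val x by exact: (set_valP x).
  rewrite -ex => /LMr; rewrite toM1 => -[v /(lattice_mem LE)[z ->] ez].
  have [i [w zE]] := rgen z; exists i; apply: set_type_eq.
  rewrite tE -ex; apply/torus_pi_eq.
  have uMC : toC M1 \in unitmx by rewrite map_unitmx.
  (* A fixed class is a priori complex; invertibility of [M - 1] makes it rational. *)
  have -> : e = toC (y i + B *m map_mx intr w).
    apply: (can_inj (mulKmx uMC)); rewrite ez -map_mxM mulmxDr yE mulmxA CE.
    by rewrite -mulmxA -map_mxM -mulmxDr -map_mxD zE.
  exists (- (B *m map_mx intr w)).
    apply/(lattice_mem LE); exists (- w).
    by rewrite map_mxN mulmxN.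
  rewrite -map_mxB; congr (map_mx _ _); zmod.
(* [M - 1] sends a lift of a simplex of fixed points into the lattice, so the lift is constant, and
   so is the simplex. *)
- move=> k f x x'; have [s sf] := torus_lift_set_type f.
  have gc : continuous (fun x => toC M1 *m s x).
    move=> u; apply: (continuous_comp (x := u)); first exact: cts_fun.
    exact: mulmx_continuous.
  have gL u : in_lattice L (mkcts gc u).
    rewrite /mkcts -toM1; apply/LMr; rewrite sf; exact: (set_valP (f u)).
  have := in_lattice_constant uB LE (g := mkcts gc) gL x x'.
  have uMC : toC M1 \in unitmx by rewrite map_unitmx.
  move=> /(can_inj (mulKmx uMC)) e.
  by apply: set_type_eq; rewrite -!sf e.
Qed.

End TorusEuler.

(** * The orbifold Euler characteristic *)

Local Close Scope classical_set_scope.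

Section FixedPointFree.
Variables (gT : finGroupType) (G : {group gT}) (n : nat).
Variables (rG : mx_representation rat G n) (hV : FPF_representation rG).

Lemma FPF_det g : g \in G -> g != 1%g ->
  exists2 k, n = (k * totient #[g]%g)%N &
    `|\det (rG g - 1%:M)| = (prime_base #[g]%g ^ k)%:R.
Proof.
move=> Gg g1; have [_ free] := hV.
apply: (@det_fixed_point_free n (rG g) (fun k => rG (g ^+ k)%g)).
- by rewrite order_gt1.
- by rewrite expg0 repr_mx1.
- by move=> k; rewrite expgS repr_mxM ?groupX.
- by rewrite expg_order repr_mx1.
- move=> k /andP[k0 kd]; apply: free; first exact: groupX.
  by rewrite -order_dvdn gtnNdvd.
Qed.

Lemma FPF_fixed_euler (R : realType) (L : lattice n) g :
  lattice_invariant rG L -> g \in G -> g != 1%g ->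
  has_euler_char R
    (set_type (fixed_points (fun t : torus R L => torus_map (rG g) t)))
    (prime_base #[g]%g ^ (n %/ totient #[g]%g))%N%:Z.
Proof.
move=> hL Gg g1; have [_ free] := hV; have [k nk detk] := FPF_det Gg g1.
apply: torus_fixed_euler => [v||]; [exact: hL| |exact: free].
by rewrite detk {1}nk mulnK // totient_gt0 order_gt0.
Qed.

End FixedPointFree.

Theorem corollary4p8 (R : realType) (m : nat) (hm : (2 <= m)%N)
    (gT : finGroupType) (G : {group gT})
    (hG : (G \isog Grp (a : b :
             a ^+ (2 * m) = 1, b ^+ 2 = a ^+ m, b * a * b^-1 = a^-1))%g)
    (n : nat) (rG : mx_representation rat G n) (hV : FPF_representation rG)
    (L : lattice n) (hL : lattice_invariant rG L) :
  has_orbifold_euler_char R G (fun g (t : torus R L) => torus_map (rG g) t)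
    (2 `^ (n%:R / 2 - 1) + 1 / 2 - 1 / (4 * m)%:R +
     1 / (4 * m)%:R *
       \sum_(0 <= p < (2 * m).+1 | prime p)
         \sum_(1 <= k < (2 * m).+1 | (p ^ k %| 2 * m)%N)
           (totient (p ^ k))%:R *
             (p%:R `^ (n%:R / (totient (p ^ k))%:R) - 1)).
Proof.
have [n_gt0 _] := hV; have [a [oa oG aG out]] := quaternion_structure hm hG.
(* The identity is singled out: its fixed set is the whole torus, of Euler characteristic 0, whereas
   [prime_base 1] is 1. *)
pose f d := (if d == 1 then 0 else prime_base d ^ (n %/ totient d))%N.
exists (fun g => (f #[g]%g)%:Z); split=> [g Gg|].
  rewrite /f order_eq1; case: eqVneq => [->|g1]; last exact: FPF_fixed_euler.
  by rewrite repr_mx1; exact: torus_euler.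
(* The truncated quotient in [f] is exact because [FPF_det] makes [n] a multiple of the totient, so
   the real and natural powers agree. *)
have fE g : g \in G -> (1 < #[g]%g)%N ->
    (f #[g]%g)%:R = (prime_base #[g]%g)%:R `^ (n%:R / (totient #[g]%g)%:R) :> R.
  move=> Gg g1; rewrite /f gtn_eqF //; rewrite order_gt1 in g1.
  have [k nk _] := FPF_det hV Gg g1.
  have t0 : (0 < totient #[g]%g)%N by rewrite totient_gt0 order_gt0.
  rewrite {2}nk natrM mulfK ?pnatr_eq0 -?lt0n // powR_mulrn ?ler0n //.
  by rewrite nk mulnK // natrX.
have m0 : (0 < m)%N := ltnW hm.
(* An element of order 4 is exhibited because the divisibility of [n] by [totient 4] is obtained
   from group elements. *)
have [g Gg ga] : exists2 g, g \in G & g \notin <[a]>%g.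
  apply/subsetPn; apply: contraTN isT => /subset_leq_card.
  by rewrite -orderE oa oG leq_pmul2r.
have f4 : (f 4)%:R = 2 * 2 `^ (n%:R / 2 - 1) :> R.
  have g4 := out g Gg ga; have := fE g Gg; rewrite g4 => -> //.
  rewrite [totient 4]/= [prime_base 4]/=.
  rewrite [in LHS](_ : n%:R / 2 = 1 + (n%:R / 2 - 1) :> R);
    last by rewrite addrC subrK.
  by rewrite powRD ?pnatr_eq0 ?implybT // powRr1.
have odE d : (1 < d)%N -> (d %| 2 * m)%N ->
    (f d)%:R = (prime_base d)%:R `^ (n%:R / (totient d)%:R) :> R.
  move=> d1 dN; have oc : #[a ^+ ((2 * m) %/ d)]%g = d.
    rewrite orderXdiv oa ?dvdn_div // divnA ?mulKn ?muln_gt0 //.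
  by rewrite -oc fE ?oc // groupX // -cycle_subG.
have sumG : \sum_(g in G) (f #[g]%g)%:Z%:~R = _ :> R :=
  quaternion_sum hm hG (fun d => (f d)%:R).
rewrite sumG f4 oG.
(* Subtracting 1 makes [F] vanish away from prime powers, where [prime_base] is 1, as the regrouping
   by [p] and [k] requires. *)
pose F d : R :=
  (totient d)%:R * ((prime_base d)%:R `^ (n%:R / (totient d)%:R) - 1).
have one_lt : (1 < (2 * m).+1)%N by rewrite ltnS muln_gt0.
have split1 (V : nmodType) (h : nat -> V) :
    \sum_(d < (2 * m).+1 | (d %| 2 * m)%N) h d =
    h 1%N + \sum_(d < (2 * m).+1 | (1 < d)%N && (d %| 2 * m)%N) h d.
  rewrite (bigD1 (Ordinal one_lt)) ?dvd1n //=; congr (_ + _).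
  apply: eq_bigl => d; rewrite andbC; case dN : (d %| 2 * m)%N;
    last by rewrite !andbF.
  rewrite !andbT -val_eqE /= ltn_neqAle eq_sym andbC.
  by rewrite (dvdn_gt0 _ dN) // muln_gt0.
have sumF : \sum_(d < (2 * m).+1 | (d %| 2 * m)%N) (f d)%:R *+ totient d =
    (2 * m)%:R - 1 + \sum_(d < (2 * m).+1 | (1 < d)%N && (d %| 2 * m)%N) F d.
  rewrite (split1 _ (fun d => (f d)%:R *+ totient d)) /= add0r.
  have := congr1 (fun k => k%:R : R) (sum_totient_dvd (2 * m)).
  rewrite natr_sum (split1 _ (fun d => (totient d)%:R)) => <-.
  rewrite [totient 1]/= [_ + _ - 1]addrAC subrr add0r -big_split.
  apply: eq_bigr => d /andP[d1 dN].
  by rewrite odE // /F -mulr_natl /= mulrBr mulr1 subrKC.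
have ppF : \sum_(d < (2 * m).+1 | (1 < d)%N && (d %| 2 * m)%N) F d =
    \sum_(0 <= p < (2 * m).+1 | prime p)
      \sum_(1 <= k < (2 * m).+1 | (p ^ k %| 2 * m)%N)
        (totient (p ^ k))%:R * (p%:R `^ (n%:R / (totient (p ^ k))%:R) - 1).
  have N0 : (0 < 2 * m)%N by rewrite muln_gt0.
  have F0 e : (1 < e)%N ->
      (forall p k, prime p -> (0 < k)%N -> e <> (p ^ k)%N) -> F e = 0.
    move=> e1 epp; rewrite /F prime_base_not_prime_power //.
    by rewrite powR1 subrr mulr0.
  rewrite (big_prime_power_divisors _ N0 F0) /=.
  apply: eq_bigr => p pr_p; rewrite [LHS]big_nat_cond [RHS]big_nat_cond.
  apply: eq_bigr => k /andP[/andP[k0 _] _].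
  by rewrite /F prime_base_prime_power.
rewrite sumF -ppF; move: (\sum_(d < _ | _) F d) (_ `^ _) => S P.
rewrite -mulr_natl !natrM.
by field; rewrite pnatr_eq0 -lt0n.
Qed.
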